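(* Let $D$ be the complete geometric graph on $n$ vertices whose vertices are chosen independently and uniformly at random from the unit square $[0,1]\times[0,1]$. Let $\chi_{slope}$ be the edge coloring of $D$ in which an edge is colored red if it has positive slope and blue otherwise. Then \[ \mathbb{E}\left[\overline{\operatorname{cr}}(D,\chi_{slope})\right] = \frac{1}{4}\binom{n}{4} = \frac{18}{50}\cdot \mathbb{E}\left[\overline{\operatorname{cr}}(D)\right] = \left(\frac{1}{2}-\frac{7}{50}\right)\mathbb{E}\left[\overline{\operatorname{cr}}(D)\right]. \]
   Context: A geometric graph is a graph whose vertex set is a set of points in general position in the plane and whose edges are straight line segments joining these points; it is complete if every pair of vertices is joined by an edge. The number of crossings $\overline{\operatorname{cr}}(D)$ of a geometric graph $D$ is the number of (unordered) pairs of its edges that intersect in their interiors. For an edge coloring $\chi$ of $D$, $\overline{\operatorname{cr}}(D,\chi)$ denotes the number of (unordered) pairs of edges of $D$ of the same color that cross, i.e., intersect in their interiors. Horizontal and vertical edges are colored blue. *)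

(* Defs.v *)
From HB Require Import structures.
From mathcomp Require Import all_boot all_order all_algebra.
From mathcomp Require Import all_classical all_reals all_analysis.
Set Implicit Arguments.
Unset Strict Implicit.
Unset Printing Implicit Defensive.
Import Order.TTheory GRing.Theory Num.Theory.
Local Open Scope classical_set_scope.
Local Open Scope ring_scope.

Notation plane R := (measurableTypeR R * measurableTypeR R)%type.

Section GeometricGraph.
Variables (R : realType) (V : finType).

(* A geometric graph is given by the positions [p] of its vertices and its set
   [E] of edges, an edge being a 2-element set of vertices.  General position is
   not built into the type; for i.i.d. uniform points it holds almost surely. *)
Implicit Types (p : V -> plane R) (E : {set {set V}}) (e f : {set V}).

Definition complete_edges : {set {set V}} := [set e : {set V} | #|e| == 2]%SET.

Definition edge_interior p e : set (plane R) :=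
  [set z | exists i j (t : R), [/\ e = [set i; j]%SET, 0 < t < 1 &
     z = ((1 - t) * (p i).1 + t * (p j).1, (1 - t) * (p i).2 + t * (p j).2)]].

Definition cross p e f : Prop := edge_interior p e `&` edge_interior p f !=set0.

Definition crossing_pairs p E : {set {set {set V}}} :=
  [set c : {set {set V}} | `[< exists e f, [/\ c = [set e; f]%SET,
     e \in E, f \in E, e != f & cross p e f] >]]%SET.

Definition cr p E : nat := #|crossing_pairs p E|.

Definition mono_crossing_pairs (C : Type) p E (chi : {set V} -> C) :
    {set {set {set V}}} :=
  [set c : {set {set V}} | `[< exists e f, [/\ c = [set e; f]%SET,
     e \in E, f \in E, e != f & cross p e f /\ chi e = chi f] >]]%SET.

Definition cr_mono (C : Type) p E (chi : {set V} -> C) : nat :=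
  #|mono_crossing_pairs p E chi|.

(* Division by zero yields 0, so a vertical line gets slope 0, which is not
   positive. *)
Definition slope (a b : plane R) : R := (b.2 - a.2) / (b.1 - a.1).

(* [true] is red and [false] is blue; horizontal and vertical edges are blue. *)
Definition chi_slope p e : bool :=
  `[< exists i j, e = [set i; j]%SET /\ 0 < slope (p i) (p j) >].

End GeometricGraph.

Section RandomPoints.
Context d (T : measurableType d) (R : realType) (P : probability T R).

Definition mutually_independent (I : finType) d' (T' : measurableType d')
    (X : I -> {RV P >-> T'}) : Prop :=
  forall (J : {set I}) (A : I -> set T'), (forall i, measurable (A i)) ->
    P (\bigcap_(i in [set` J]) (X i @^-1` A i)) =
    (\prod_(i in J) P (X i @^-1` A i))%E.

(* The unit square has area 1, so no normalization is needed. *)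
Definition uniform_on_unit_square (X : {RV P >-> plane R}) : Prop :=
  forall A : set (plane R), measurable A ->
    distribution P X A =
    (@lebesgue_measure R \x @lebesgue_measure R)%E
      (A `&` (`[0, 1] `*` `[0, 1])).

End RandomPoints.

(* Main.v *)
Require Import Defs.
From HB Require Import structures.
From mathcomp Require Import all_boot all_order all_algebra.
From mathcomp Require Import all_classical all_reals all_analysis.
From mathcomp Require Import ring lra measurable_realfun.
Set Implicit Arguments.
Unset Strict Implicit.
Unset Printing Implicit Defensive.
Import Order.TTheory GRing.Theory Num.Theory.
Import numFieldNormedType.Exports.
Local Open Scope classical_set_scope.
Local Open Scope ring_scope.

(* Sort four points by abscissa as a, b, c, d.  Two disjoint edges on them can
   only cross as ac x bd or ad x bc, and one of the two crossings occurs unless b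
   or c lies in the triangle spanned by the other three points.  Up to the
   reflections of the square the latter is a single event, [inner_second], so the
   crossing probability is 1/24 - 4 * 11/3456 = 25/864 per ordered quadruple, that
   is 25/36 per 4-element set.  A monochromatic crossing is, up to the same
   reflections, one of four events with positive slopes, of total probability
   1/96 per ordered quadruple.  In each event the eight coordinates can be
   integrated out in an order for which every coordinate ranges over an interval
   contained in [0, 1] and every intermediate integrand is a polynomial of degree
   at most 3 in the next coordinate.  Almost surely no two coordinates agree and no
   three points are collinear; then the number of crossings is the number of
   ordered quadruples realizing one of the two crossing patterns. *)

(** * Independent uniform variables and product laws *)

Section law.
Context d (T : measurableType d) (R : realType) (P : probability T R).
Local Notation RR := (measurableTypeR R).

(** The choice of events is dictated by the boundary of the square. The height of a line between two
    of its vertices is a convex combination of their ordinates and stays in [0, 1], whereas a height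
    extrapolated past a vertex may leave the square and break the integrand into pieces. Hence the
    crossing probability is reached through its complement, where every bound is interpolated, and
    the monochromatic crossings are cut into increasing configurations. There the only extrapolated
    bound is the line ab prolonged to the abscissa of c in [inc1324_cup]; it rises from a, so it
    stays above 0, and it is kept below the chord bd by placing b under ad. Counted with their
    mirror images, the four increasing events [inc1324_cup], [inc1324_dip], [inc1423_above],
    [inc1423_below] have multiplicities 4, 4, 2, 2, whence (4 * 1 + 4 * 2 + 2 * 1 + 2 * 11) / 3456 =
    1/96. *)

Definition lambda01 : probability RR R := uniform_prob (@ltr01 R).

Lemma lambda01E (A : set RR) : measurable A ->
  lambda01 A = @lebesgue_measure R (A `&` `[0, 1]).
Proof.
move=> mA; apply: etrans (integral_uniform_pdf 0 1 A) _.
rewrite (eq_integral (cst 1%E)) ?integral_cst ?mul1e//.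
  by apply: measurableI => //; exact: measurable_itv.
move=> x /[!inE] -[_ /=]; rewrite in_itv/= => x01.
by rewrite /uniform_pdf x01 subr0 invr1.
Qed.

Section family.
Variables (K : finType) (Z : K -> T -> RR).

(** Stating the product formula for the full family suffices: for a subfamily, take [A k = setT]
    elsewhere, which contributes factors 1. *)
Definition indep_uniform := (forall k, measurable_fun setT (Z k)) /\
  forall A : K -> set RR, (forall k, measurable (A k)) ->
    P (\bigcap_k (Z k @^-1` A k)) = (\prod_k lambda01 (A k))%E.

(* [W] has law [nu] and is independent of the [Z k] with [k \notin s]. *)
Definition joint_law (s : seq K) d' (S : measurableType d') (W : T -> S)
    (nu : probability S R) := measurable_fun setT W /\
  forall (A : K -> set RR) (B : set S), (forall k, measurable (A k)) ->
    (forall k, k \in s -> A k = setT) -> measurable B ->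
    P (W @^-1` B `&` \bigcap_k (Z k @^-1` A k)) =
    (nu B * \prod_k lambda01 (A k))%E.

Hypothesis ZU : indep_uniform.

Lemma joint_law1 k : joint_law [:: k] (Z k) lambda01.
Proof.
case: ZU => mZ ZE; split => // A B mA A1 mB.
pose A' j := if j == k then B else A j.
have -> : Z k @^-1` B `&` \bigcap_j (Z j @^-1` A j) =
    \bigcap_j (Z j @^-1` A' j).
  apply/seteqP; split=> [w [Bw Aw] j _|w Aw]; rewrite /A'/=.
    by case: eqP => [->//|_]; exact: Aw.
  split=> [|j _]; first by have := Aw k I; rewrite /A' eqxx.
  have := Aw j I; rewrite /A'; case: eqP => [-> _|//].
  by rewrite A1 ?inE.
rewrite ZE; last by move=> j; rewrite /A'; case: ifP.
rewrite (bigD1 k)//= [in RHS](bigD1 k)//= /A' eqxx (A1 k) ?inE//.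
rewrite probability_setT mul1e; congr (_ * _)%E.
by apply: eq_bigr => j /negbTE ->.
Qed.

(** For fixed [A], both sides are finite measures in [B]: the law of the pair restricted to the
    event [C], and a scaled product measure. They agree on rectangles, a generating class stable
    under intersection, hence everywhere. *)
Lemma joint_law_cons (s : seq K) d' (S : measurableType d') (W : T -> S)
    (nu : probability S R) k : joint_law s W nu -> k \notin s ->
  joint_law (k :: s) (fun w => (Z k w, W w)) (lambda01 \x nu)%E.
Proof.
case: ZU => mZ ZE [mW WE] ks.
have mZW : measurable_fun setT (fun w => (Z k w, W w)).
  exact: measurable_fun_pair.
split => // A B mA A1 mB.
set C := \bigcap_j (Z j @^-1` A j).
have mC : measurable C.
  apply: fin_bigcap_measurable => // j _.
  by rewrite -[X in measurable X]setTI; exact: mZ.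
have c0 : 0 <= fine (\prod_j lambda01 (A j))%E.
  by apply: fine_ge0; apply: prode_ge0.
pose m1' : {measure set (RR * S) -> \bar R} :=
  pushforward (mrestr P mC) (fun w => (Z k w, W w)).
pose m1 := m1' mZW.
pose m2 : {measure set (RR * S) -> \bar R} :=
  mscale (NngNum c0) (lambda01 \x nu)%E.
have cE : (fine (\prod_j lambda01 (A j)))%:E = (\prod_j lambda01 (A j))%E.
  by rewrite fineK// prode_fin_num// => j _; exact: fin_num_measure.
suff E : m1 B = m2 B.
  apply: etrans E _; rewrite [RHS]muleC.
  by congr (_ * _)%E; exact: cE.
pose G : set (set (RR * S)) :=
  [set C | exists A, measurable A /\ exists B, measurable B /\ C = A `*` B].
apply: (measure_unique G (fun=> setT)) => //.
- rewrite measurable_prod_measurableType //; congr (<<s _ >>).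
  rewrite predeqE; split => [[X mX [Y mY <-]]|[X [mX [Y [mY ->]]]]].
    by exists X; split => //; exists Y.
  by exists X => //; exists Y.
- move=> /= _ _ [X1 [mX1 [X2 [mX2 ->]]]] [Y1 [mY1 [Y2 [mY2 ->]]]].
  rewrite -setXI; exists (X1 `&` Y1); split; first exact: measurableI.
  by exists (X2 `&` Y2); split => //; exact: measurableI.
- by move=> n; exists setT; split => //; exists setT; split=> //; rewrite setXTT.
- by rewrite bigcup_const.
- move=> _ [X [mX [Y [mY ->]]]].
  have -> : m2 (X `*` Y) =
      ((\prod_j lambda01 (A j)) * (lambda01 X * nu Y))%E.
    by congr (_ * _)%E; [exact: cE|exact: product_measure1E].
  rewrite /m1 /m1' /=.
  (* The condition [Z k w \in X] is absorbed into the family [A] at the index [k], which is free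
     because [A k = setT]; [k \notin s] then makes the law of [W] applicable. *)
  pose A' j := if j == k then X else A j.
  rewrite /pushforward /mrestr.
  have -> : (fun w => (Z k w, W w)) @^-1` (X `*` Y) `&` C =
      W @^-1` Y `&` \bigcap_j (Z j @^-1` A' j).
    apply/seteqP; split=> [w [[/= Xw Yw] Cw]|w [Yw Aw]]; split => //=.
    - move=> j _; rewrite /A' /=; case: eqP => [->//|_]; exact: Cw.
    - by split => //; have := Aw k I; rewrite /A' eqxx.
    - move=> j _; have := Aw j I; rewrite /A'; case: eqP => [-> _|//].
      by rewrite A1 ?inE ?eqxx.
  rewrite WE//; last 2 first.
  - by move=> j; rewrite /A'; case: ifP.
  - move=> j js; rewrite /A'; case: eqP => [jk|_].
      by move: ks; rewrite -jk js.
    by apply: A1; rewrite inE js orbT.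
  have -> : (\prod_j lambda01 (A' j) = lambda01 X * \prod_j lambda01 (A j))%E.
    rewrite (bigD1 k)//= [in RHS](bigD1 k)//= /A' eqxx (A1 k) ?inE ?eqxx//.
    rewrite probability_setT mul1e; congr (_ * _)%E.
    by apply: eq_bigr => j /negbTE ->.
  by rewrite muleA [LHS]muleC (muleC (nu Y)).
- move=> n; apply: le_lt_trans (ltry 1); apply: probability_le1.
  by apply: measurableI => //; rewrite preimage_setT.
Qed.

Lemma joint_lawE s d' (S : measurableType d') (W : T -> S)
    (nu : probability S R) B : joint_law s W nu -> measurable B ->
  P (W @^-1` B) = nu B.
Proof.
move=> [mW WE] mB.
have -> : W @^-1` B = W @^-1` B `&` \bigcap_(k : K) (Z k @^-1` setT).
  by apply/seteqP; split=> [w Bw|w []].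
by rewrite WE// big1 ?mule1// => k _; exact: probability_setT.
Qed.

End family.
End law.

(** * Iterated integrals of piecewise polynomials *)

Section iterated_integrals.
Context (R : realType).
Local Notation RR := (measurableTypeR R).
Implicit Types f g : R -> \bar R.

(* The open interval makes the values at 0 and 1 irrelevant. *)
Definition I01 f : \bar R := (\int[@lebesgue_measure R]_(x in `]0%R, 1%R[) f x)%E.

Lemma eq_I01 f g : (forall x, 0 < x < 1 -> f x = g x) -> I01 f = I01 g.
Proof.
move=> fg; apply: eq_integral => x; rewrite inE/= in_itv/=; exact: fg.
Qed.

Lemma I01_eq0 f : (forall x, 0 < x < 1 -> f x = 0%E) -> I01 f = 0%E.
Proof. by move=> f0; rewrite (eq_I01 f0); exact: integral0. Qed.

Lemma lambda01_prodE d' (S : measurableType d') (nu : probability S R)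
    (e : RR * S -> bool) : measurable_fun setT e ->
  (lambda01 R \x nu)%E [set x | e x] = I01 (fun z => nu [set y | e (z, y)]).
Proof.
move=> me.
have mB : measurable [set x | e x].
  by rewrite -[X in measurable X]setTI; exact: (me measurableT [set true]).
rewrite /product_measure1 integral_uniform//; last first.
  exact: measurable_fun_xsection.
rewrite subr0 invr1 mul1e (@integral_itv_bndoo _ _ _ _ true false); last first.
  by apply: measurable_funTS; exact: measurable_fun_xsection.
apply: eq_integral => z _ /=.
by congr (nu _); apply/seteqP; split=> y; rewrite /xsection/= ?inE.
Qed.

Lemma lambda01_I01 (e : RR -> bool) : measurable_fun setT e ->
  lambda01 R [set x | e x] = I01 (fun z => (e z)%:R%:E).
Proof.
move=> me.
have mB : measurable [set x | e x].
  by rewrite -[X in measurable X]setTI; exact: (me measurableT [set true]).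
have m01 : measurable (`[0, 1] : set RR) by exact: measurable_itv.
rewrite lambda01E// -[LHS]/(lebesgue_measure ([set x | e x] `&` `[0, 1])).
rewrite -(integral_indic lebesgue_measure m01 mB).
rewrite (@integral_itv_bndoo _ _ _ _ true false); last first.
  by apply: measurable_funTS; apply: measurableT_comp => //; exact: measurable_indic.
apply: eq_integral => x _; rewrite indicE; congr (_%:R%:E).
by congr nat_of_bool; apply/idP/idP; rewrite inE.
Qed.

Lemma derive_poly_seg (a x : R) (c0 c1 c2 c3 c4 : R) :
  is_derive x 1 (fun y => c0 * (y - a) + c1 / 2 * (y - a) ^+ 2
     + c2 / 3 * (y - a) ^+ 3 + c3 / 4 * (y - a) ^+ 4 + c4 / 5 * (y - a) ^+ 5)
   (c0 + c1 * (x - a) + c2 * (x - a) ^+ 2 + c3 * (x - a) ^+ 3 + c4 * (x - a) ^+ 4).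
Proof.
apply: is_derive_eq.
by rewrite /GRing.scale/=; field.
Qed.

(** The fundamental theorem of calculus. In powers of [x - a] the antiderivative vanishes at [a], so
    the value involves only the coefficients and the length [b - a]. *)
Lemma I01_seg (c0 c1 c2 c3 c4 a b : R) f :
  0 <= a -> a <= b -> b <= 1 ->
  (forall x, a < x < b -> f x = (c0 + c1 * (x - a) + c2 * (x - a) ^+ 2
    + c3 * (x - a) ^+ 3 + c4 * (x - a) ^+ 4)%:E) ->
  (forall x, 0 < x < 1 -> (x <= a) || (b <= x) -> f x = 0%E) ->
  I01 f = (c0 * (b - a) + c1 / 2 * (b - a) ^+ 2 + c2 / 3 * (b - a) ^+ 3
    + c3 / 4 * (b - a) ^+ 4 + c4 / 5 * (b - a) ^+ 5)%:E.
Proof.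
move=> a0 ab b1 fab f0.
transitivity (\int[@lebesgue_measure R]_(x in `]a, b[) f x)%E.
  rewrite /I01 [LHS]integral_mkcond [RHS]integral_mkcond.
  apply: eq_integral => x _; rewrite !patchE.
  case: ifPn; rewrite ?inE ?notin_setE/= in_itv/= => x1; last first.
    case: ifPn => //; rewrite inE/= in_itv/= => x2.
    by exfalso; apply: x1; lra.
  case: ifPn => //; rewrite notin_setE/= in_itv/= => /negP x2.
  by apply: f0 => //; move: x2; rewrite negb_and -!leNgt.
pose p x := c0 + c1 * (x - a) + c2 * (x - a) ^+ 2
    + c3 * (x - a) ^+ 3 + c4 * (x - a) ^+ 4.
transitivity (\int[@lebesgue_measure R]_(x in `]a, b[) (p x)%:E)%E.
  by apply: eq_integral; move=> x; rewrite inE/= in_itv/=; exact: fab.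
move: ab; rewrite le_eqVlt => /orP[/eqP <-|ab].
  by rewrite set_itvoo0 integral_set0 subrr !expr0n/= !mulr0 !addr0.
pose F x := c0 * (x - a) + c1 / 2 * (x - a) ^+ 2
     + c2 / 3 * (x - a) ^+ 3 + c3 / 4 * (x - a) ^+ 4 + c4 / 5 * (x - a) ^+ 5.
have dF (x : R) : is_derive x (1 : R) F (p x) by exact: derive_poly_seg.
have cp : continuous p.
  move=> x; apply: differentiable_continuous; apply/derivable1_diffP.
  by rewrite /p.
have cF : continuous F.
  by move=> x; apply: differentiable_continuous; apply/derivable1_diffP; case: (dF x).
rewrite -(@integral_itv_bndoo _ _ _ _ true false); last first.
  apply: measurable_funTS; apply: measurableT_comp => //.
  exact: continuous_measurable_fun.
rewrite (@continuous_FTC2 _ p F)//.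
- by rewrite -EFinB /F subrr !expr0n/= !mulr0 !addr0 subr0.
- exact: continuous_subspaceT.
- split; first by move=> x _; case: (dF x).
    by apply: cvg_at_right_filter; exact: cF.
  by apply: cvg_at_left_filter; exact: cF.
- by move=> x _; rewrite derive1E; case: (dF x).
Qed.

(** A point is a null set. This disposes of coincidences and collinearities, which determine the
    last coordinate from the others. *)
Lemma I01_point (c : R) (f : R -> \bar R) :
  (forall x, 0 < x < 1 -> x != c -> f x = 0%E) -> I01 f = 0%E.
Proof.
move=> f0; rewrite /I01 -(@integral_setD1 _ _ c); last first.
- apply: (eq_measurable_fun (cst 0%E)) => // x; rewrite inE/= in_itv/= => -[x01 /eqP xc].
  by rewrite f0.
- by apply: measurableD => //; exact: measurable_itv.
by apply: integral0_eq => x /= []; rewrite in_itv/= => x01 /eqP xc; exact: f0.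
Qed.

End iterated_integrals.

Section iterated_probabilities.
Context d (T : measurableType d) (R : realType) (P : probability T R).
Local Notation RR := (measurableTypeR R).
Variables (K : finType) (Z : K -> T -> RR).
Hypothesis ZU : indep_uniform P Z.

(** Shaped for repeated application: the premise on sections receives their measurability, which the
    next coordinate requires. *)
Lemma lambda01_prod_eq d' (S : measurableType d') (nu : probability S R)
    (e : RR * S -> bool) g : measurable_fun setT e ->
    (forall z, measurable_fun setT (fun y => e (z, y)) ->
      nu [set y | e (z, y)] = g z) ->
  (lambda01 R \x nu)%E [set x | e x] = I01 g.
Proof.
move=> me eg; apply: etrans (lambda01_prodE _ me) _.
by apply: eq_I01 => z _; apply: eg; exact: measurable_fun_pair2.
Qed.

Lemma measurable_pred d1 (T1 : measurableType d1) (e : T1 -> bool) :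
  measurable_fun setT e -> measurable [set x | e x].
Proof.
by move=> me; rewrite -[X in measurable X]setTI; exact: (me measurableT [set true]).
Qed.

Lemma prob_iterated2 k1 k2 (e : RR * RR -> bool) :
  uniq [:: k1; k2] -> measurable_fun setT e ->
  P [set w | e (Z k1 w, Z k2 w)] =
  I01 (fun z1 => I01 (fun z2 => (e (z1, z2))%:R%:E)).
Proof.
rewrite /= inE andbT => k12 me.
have JL := joint_law_cons ZU (joint_law1 ZU k2) (k:=k1).
rewrite inE in JL; move/(_ k12) in JL.
rewrite -[LHS]/(P ((fun w => (Z k1 w, Z k2 w)) @^-1` [set z | e z])).
apply: etrans (joint_lawE JL (measurable_pred me)) _.
by apply: (lambda01_prod_eq me) => ? {}me; exact: lambda01_I01.
Qed.

Lemma prob_iterated6 k1 k2 k3 k4 k5 k6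
    (e : RR * (RR * (RR * (RR * (RR * RR)))) -> bool) :
  uniq [:: k1; k2; k3; k4; k5; k6] -> measurable_fun setT e ->
  P [set w | e (Z k1 w, (Z k2 w, (Z k3 w, (Z k4 w, (Z k5 w, Z k6 w)))))] =
  I01 (fun z1 => I01 (fun z2 => I01 (fun z3 => I01 (fun z4 => I01 (fun z5 =>
  I01 (fun z6 => (e (z1, (z2, (z3, (z4, (z5, z6))))))%:R%:E)))))).
Proof.
case/and5P=> u1 u2 u3 u4 /andP[u5 _] me.
have J := joint_law1 ZU k6.
have {}J := joint_law_cons ZU J u5.
have {}J := joint_law_cons ZU J u4.
have {}J := joint_law_cons ZU J u3.
have {}J := joint_law_cons ZU J u2.
have {}J := joint_law_cons ZU J u1.
apply: etrans (joint_lawE J (measurable_pred me)) _.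
do 5! (apply: (lambda01_prod_eq me) => ? {}me).
exact: lambda01_I01.
Qed.

(** Any list of distinct indices is allowed, so each event chooses its own order of integration and
    no integrals have to be exchanged. *)
Lemma prob_iterated8 k1 k2 k3 k4 k5 k6 k7 k8
    (e : RR * (RR * (RR * (RR * (RR * (RR * (RR * RR)))))) -> bool) :
  uniq [:: k1; k2; k3; k4; k5; k6; k7; k8] -> measurable_fun setT e ->
  P [set w | e (Z k1 w, (Z k2 w, (Z k3 w, (Z k4 w, (Z k5 w, (Z k6 w,
    (Z k7 w, Z k8 w)))))))] =
  I01 (fun z1 => I01 (fun z2 => I01 (fun z3 => I01 (fun z4 => I01 (fun z5 =>
  I01 (fun z6 => I01 (fun z7 => I01 (fun z8 =>
   (e (z1, (z2, (z3, (z4, (z5, (z6, (z7, z8))))))))%:R%:E)))))))).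
Proof.
case/and5P=> u1 u2 u3 u4 /and4P[u5 u6 u7 _] me.
have J := joint_law1 ZU k8.
have {}J := joint_law_cons ZU J u7.
have {}J := joint_law_cons ZU J u6.
have {}J := joint_law_cons ZU J u5.
have {}J := joint_law_cons ZU J u4.
have {}J := joint_law_cons ZU J u3.
have {}J := joint_law_cons ZU J u2.
have {}J := joint_law_cons ZU J u1.
apply: etrans (joint_lawE J (measurable_pred me)) _.
do 7! (apply: (lambda01_prod_eq me) => ? {}me).
exact: lambda01_I01.
Qed.

End iterated_probabilities.

(** * Probabilities of the basic events *)

Section events.
Context (R : realType).
Implicit Types a b c d : plane R.

(* For [a.1 < b.1 < c.1], [0 < det a b c] means that b lies below the line ac. *)
Definition det a b c : R :=
  (b.1 - a.1) * (c.2 - a.2) - (c.1 - a.1) * (b.2 - a.2).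

Definition sorted4 a b c d : bool := [&& a.1 < b.1, b.1 < c.1 & c.1 < d.1].

(* b lies inside the triangle acd, and c below the line ad. *)
Definition inner_second a b c d : bool :=
  [&& sorted4 a b c d, 0 < det a c d, det a b c < 0 & 0 < det a b d].

(* In the next four events two segments of positive slope cross: ad and bc, with
   b above or below ad; then ac and bd, with b below ac and b above or below a. *)
Definition inc1423_above a b c d : bool :=
  [&& sorted4 a b c d, a.2 < d.2, det a b d < 0, 0 < det a c d & b.2 < c.2].

Definition inc1423_below a b c d : bool :=
  [&& sorted4 a b c d, a.2 < d.2, 0 < det a b d & det a c d < 0].

Definition inc1324_cup a b c d : bool :=
  [&& sorted4 a b c d, a.2 < b.2, 0 < det a b c & 0 < det b c d].

Definition inc1324_dip a b c d : bool :=
  [&& sorted4 a b c d, b.2 < a.2, a.2 < c.2, c.2 < d.2 & 0 < det b c d].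

Definition indicator8 (e : plane R -> plane R -> plane R -> plane R -> bool)
  x1 y1 x2 y2 x3 y3 x4 y4 : \bar R := (e (x1, y1) (x2, y2) (x3, y3) (x4, y4))%:R%:E.

Lemma indic_eq0 (b : bool) : ~ b -> (b%:R)%:E = 0%E :> \bar R.
Proof. by case: b. Qed.

Lemma indic_eq1 (b : bool) (c : R) : b -> c = 1 -> (b%:R)%:E = c%:E.
Proof. by case: b => // _ ->. Qed.

Ltac kill := move=> *; do ?[apply: I01_eq0 => *]; apply: indic_eq0;
  rewrite /sorted4/= => *.
(* Evaluates an [I01] whose integrand is [\sum_i c_i * (x - a) ^+ i] on ]a, b[ and
   0 elsewhere: [z] proves the vanishing, [f] unfolds abbreviations for [field]. *)
Ltac segz z f c0 c1 c2 c3 c4 a b :=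
  apply: etrans; [apply: (@I01_seg _ c0 c1 c2 c3 c4 a b);
    [try by lra|try by lra|try by lra| |kill; z]|
    congr (_%:E); f; field; try by [|lra]].
Ltac seg c0 c1 c2 c3 c4 a b := segz ltac:(lra) ltac:(idtac) c0 c1 c2 c3 c4 a b.
Ltac segf f c0 c1 c2 c3 c4 a b := segz ltac:(lra) f c0 c1 c2 c3 c4 a b.
Ltac seg1 := seg (1:R) (0:R) (0:R) (0:R) (0:R) (0:R) (1:R).

Lemma integral_sorted4 :
  I01 (fun x4 => I01 (fun x3 => I01 (fun x2 => I01 (fun x1 =>
  I01 (fun y1 => I01 (fun y2 => I01 (fun y3 => I01 (fun y4 =>
   indicator8 sorted4 x1 y1 x2 y2 x3 y3 x4 y4)))))))) = (1 / 24)%:E.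
Proof.
(* The evaluation runs from the outside in: each polynomial announces the value of the integral over
   all remaining inner variables, which becomes the next goal. The same holds for the five integrals
   below. *)
seg (0:R) (0:R) (0:R) (1/6:R) (0:R) (0:R) (1:R) => x4 x4P.
seg (0:R) (0:R) (1/2:R) (0:R) (0:R) (0:R) x4 => x3 x3P.
seg (0:R) (1:R) (0:R) (0:R) (0:R) (0:R) x3 => x2 x2P.
seg (1:R) (0:R) (0:R) (0:R) (0:R) (0:R) x2 => x1 x1P.
seg1 => y1 y1P. seg1 => y2 y2P. seg1 => y3 y3P. seg1 => y4 y4P.
apply: indic_eq1; first (rewrite /sorted4/=); lra.
Qed.

Lemma ratio01 (a b c : R) : a < b < c -> 0 < (b - a) / (c - a) < 1.
Proof.
by move=> abc; rewrite divr_gt0 ?subr_gt0 ?ltr_pdivrMr ?subr_gt0 ?mul1r//; lra.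
Qed.

(** Guarantees that a bound read on a chord is not cut off by the square. *)
Lemma conv01 (y z t : R) : 0 < y < 1 -> 0 < z < 1 -> 0 < t < 1 ->
  0 < y + (z - y) * t < 1.
Proof. by move=> *; apply/andP; split; nra. Qed.

(** With [m] the height of ad above [x3], c ranges over heights from 0 to [m], and b between the
    chords ac ([lo]) and ad ([hi]). By similar triangles the latter interval has length
    [k * (m - y3)], so c and b together contribute [k * m ^+ 2 / 2]. *)
Lemma integral_inner_second :
  I01 (fun x4 => I01 (fun x1 => I01 (fun x3 => I01 (fun x2 =>
  I01 (fun y4 => I01 (fun y1 => I01 (fun y3 => I01 (fun y2 =>
   indicator8 inner_second x1 y1 x2 y2 x3 y3 x4 y4)))))))) = (11 / 3456)%:E.
Proof.
rewrite /indicator8 /inner_second.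
seg (0:R) (0:R) (0:R) (11/864:R) (0:R) (0:R) (1:R) => x4 x4P.
seg (11/288 * x4 ^+ 2) (- 11/144 * x4) (11/288:R) (0:R) (0:R) (0:R) x4 => x1 x1P.
seg (0:R) (1/12:R) (- 1/24 / (x4 - x1)) (1/24 / (x4 - x1) ^+ 2) (0:R) x1 x4 => x3 x3P.
set u := (x3 - x1) / (x4 - x1).
have u01 : 0 < u < 1 by exact: ratio01.
segf ltac:(rewrite /u) (0:R) ((1/6 + (u ^+ 2 - u)/12) / (x3 - x1)) (0:R) (0:R)
    (0:R) x1 x3 => x2 x2P.
set k := (x2 - x1) / (x3 - x1).
have k01 : 0 < k < 1 by exact: ratio01.
segf ltac:(rewrite /k) (k/2 * (1-u)^+2/3) (k/2*(1-u)*u) (k/2*u^+2) (0:R) (0:R)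
    (0:R) (1:R) => y4 y4P.
seg (k/2 * y4^+2 * u ^+2) (k*y4*u*(1-u)) (k/2*(1-u)^+2) (0:R) (0:R) (0:R)
    (1:R) => y1 y1P.
set m := y1 + (y4 - y1) * u.
have m01 : 0 < m < 1 by exact: conv01.
have acd y3 : det (x1, y1) (x3, y3) (x4, y4) = (x4 - x1) * (m - y3).
  by rewrite /det/= /m /u; field; lra.
segz ltac:(rewrite acd; nra) ltac:(rewrite /m) (k * m) (-k) (0:R) (0:R) (0:R)
    (0:R) m => y3 y3P.
set lo := y1 + (y3 - y1) * k.
set hi := y1 + (y4 - y1) * ((x2 - x1) / (x4 - x1)).
have lo01 : 0 < lo < 1 by apply: conv01 => //; lra.
have hi01 : 0 < hi < 1 by apply: conv01 => //; apply: ratio01; lra.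
have hl : hi - lo = k * (m - y3) by rewrite /hi /lo /k /m /u; field; lra.
have abc y2 : det (x1, y1) (x2, y2) (x3, y3) = (x3 - x1) * (lo - y2).
  by rewrite /det/= /lo /k; field; lra.
have abd y2 : det (x1, y1) (x2, y2) (x4, y4) = (x4 - x1) * (hi - y2).
  by rewrite /det/= /hi; field; lra.
segz ltac:(rewrite abc abd acd; nra) ltac:(rewrite hl)
  (1:R) (0:R) (0:R) (0:R) (0:R) lo hi.
- by nra.
- move=> y2 y2P; apply: indic_eq1; last by lra.
  by rewrite acd abc abd /sorted4/=; nra.
Qed.
(** If [l2] and [l3] are the heights of ad above [x2] and [x3], the conditions on b and c become
    [l2 < y2 < y3 < l3]: a triangle of area [(l3 - l2) ^+ 2 / 2], where
    [l3 - l2 = (y4 - y1) * (v - u)]. *)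
Lemma integral_inc1423_above :
  I01 (fun x4 => I01 (fun x1 => I01 (fun x3 => I01 (fun x2 =>
  I01 (fun y4 => I01 (fun y1 => I01 (fun y3 => I01 (fun y2 =>
   indicator8 inc1423_above x1 y1 x2 y2 x3 y3 x4 y4)))))))) = (1 / 3456)%:E.
Proof.
rewrite /indicator8 /inc1423_above.
seg (0:R) (0:R) (0:R) (1/864:R) (0:R) (0:R) (1:R) => x4 x4P.
seg (1/288 * x4 ^+ 2) (- 1/144 * x4) (1/288:R) (0:R) (0:R) (0:R) x4 => x1 x1P.
seg (0:R) (0:R) (0:R) (1/72 / (x4 - x1) ^+ 2) (0:R) x1 x4 => x3 x3P.
seg (1/24 * (x3 - x1) ^+ 2 / (x4 - x1) ^+ 2) (- 1/12 * (x3 - x1) / (x4 - x1) ^+ 2)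
  (1/24 / (x4 - x1) ^+ 2) (0:R) (0:R) x1 x3 => x2 x2P.
set u := (x2 - x1) / (x4 - x1); set v := (x3 - x1) / (x4 - x1).
have u01 : 0 < u < 1 by apply: ratio01; lra.
have v01 : 0 < v < 1 by exact: ratio01.
have vu : v - u = (x3 - x2) / (x4 - x1) by rewrite /u /v; field; lra.
have vu0 : 0 < v - u by rewrite vu divr_gt0; lra.
segf ltac:(rewrite /u /v) (0:R) (0:R) (0:R) ((v - u) ^+ 2 / 6) (0:R) (0:R)
    (1:R) => y4 y4P.
seg ((v - u) ^+ 2 / 2 * y4 ^+ 2) (- (v - u) ^+ 2 * y4) ((v - u) ^+ 2 / 2) (0:R)
    (0:R) (0:R) y4 => y1 y1P.
set l2 := y1 + (y4 - y1) * u; set l3 := y1 + (y4 - y1) * v.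
have l201 : 0 < l2 < 1 by apply: conv01 => //; lra.
have l301 : 0 < l3 < 1 by apply: conv01 => //; lra.
have l23 : l3 - l2 = (y4 - y1) * (v - u) by rewrite /l2 /l3; ring.
have l230 : 0 < l3 - l2 by rewrite l23 mulr_gt0; lra.
have abd y2 : det (x1, y1) (x2, y2) (x4, y4) = (x4 - x1) * (l2 - y2).
  by rewrite /det/= /l2 /u; field; lra.
have acd y3 : det (x1, y1) (x3, y3) (x4, y4) = (x4 - x1) * (l3 - y3).
  by rewrite /det/= /l3 /v; field; lra.
segz ltac:(rewrite acd abd; nra) ltac:(rewrite /l3 /l2) (0:R) (1:R) (0:R) (0:R)
    (0:R) l2 l3 => y3 y3P.
segz ltac:(rewrite abd; nra) ltac:(idtac) (1:R) (0:R) (0:R) (0:R) (0:R) l2 y3 => y2 y2P.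
apply: indic_eq1; last by lra.
by rewrite acd abd /sorted4/=; nra.
Qed.

(** Given a, d and the abscissae, b and c vary independently, b from 0 up to the chord ad and c from
    the chord up to 1, which gives the area [l2 * (1 - l3)]. *)
Lemma integral_inc1423_below :
  I01 (fun x4 => I01 (fun x1 => I01 (fun x3 => I01 (fun x2 =>
  I01 (fun y4 => I01 (fun y1 => I01 (fun y3 => I01 (fun y2 =>
   indicator8 inc1423_below x1 y1 x2 y2 x3 y3 x4 y4)))))))) = (11 / 3456)%:E.
Proof.
rewrite /indicator8 /inc1423_below.
seg (0:R) (0:R) (0:R) (11/864:R) (0:R) (0:R) (1:R) => x4 x4P.
seg (11/288 * x4 ^+ 2) (- 11/144 * x4) (11/288:R) (0:R) (0:R) (0:R) x4 => x1 x1P.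
seg (0:R) (1/12:R) (1/48 / (x4 - x1)) (- 1/24 / (x4 - x1) ^+ 2) (0:R) x1 x4 => x3 x3P.
set v := (x3 - x1) / (x4 - x1).
segf ltac:(rewrite /v) (1/12 - v/24) ((1/8 - v/12) / (x4 - x1)) (0:R) (0:R)
    (0:R) x1 x3 => x2 x2P.
set u := (x2 - x1) / (x4 - x1).
have u01 : 0 < u < 1 by apply: ratio01; lra.
have v01 : 0 < v < 1 by exact: ratio01.
segf ltac:(rewrite /u) (0:R) (0:R) ((1 + u)/2) (- (1/3 + u/6 + v/6 + u * v/3))
    (0:R) (0:R) (1:R) => y4 y4P.
seg (y4 * u * (1 - y4 * v)) ((1 - u) * (1 - y4 * v) - y4 * u * (1 - v))
    (- (1 - u) * (1 - v)) (0:R) (0:R) (0:R) y4 => y1 y1P.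
set l2 := y1 + (y4 - y1) * u; set l3 := y1 + (y4 - y1) * v.
have l201 : 0 < l2 < 1 by apply: conv01 => //; lra.
have l301 : 0 < l3 < 1 by apply: conv01 => //; lra.
have abd y2 : det (x1, y1) (x2, y2) (x4, y4) = (x4 - x1) * (l2 - y2).
  by rewrite /det/= /l2 /u; field; lra.
have acd y3 : det (x1, y1) (x3, y3) (x4, y4) = (x4 - x1) * (l3 - y3).
  by rewrite /det/= /l3 /v; field; lra.
segz ltac:(rewrite acd; nra) ltac:(rewrite /l3 /l2) l2 (0:R) (0:R) (0:R) (0:R)
    l3 (1:R) => y3 y3P.
segz ltac:(rewrite abd; nra) ltac:(idtac) (1:R) (0:R) (0:R) (0:R) (0:R) (0:R)
    l2 => y2 y2P.
apply: indic_eq1; last by lra.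
by rewrite acd abd /sorted4/=; nra.
Qed.

(** Here c lies between the line ab prolonged ([lo]) and the chord bd ([hi]). The gap [hi - lo]
    equals [b / u * (h - y2)], where [h] is the height of ad above [x2]; so b must lie below ad, and
    its height ranges from [y1] to [h]. *)
Lemma integral_inc1324_cup :
  I01 (fun x4 => I01 (fun x1 => I01 (fun x2 => I01 (fun x3 =>
  I01 (fun y4 => I01 (fun y1 => I01 (fun y2 => I01 (fun y3 =>
   indicator8 inc1324_cup x1 y1 x2 y2 x3 y3 x4 y4)))))))) = (1 / 3456)%:E.
Proof.
rewrite /indicator8 /inc1324_cup.
seg (0:R) (0:R) (0:R) (1/864:R) (0:R) (0:R) (1:R) => x4 x4P.
seg (1/288 * x4 ^+ 2) (- 1/144 * x4) (1/288:R) (0:R) (0:R) (0:R) x4 => x1 x1P.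
seg (0:R) (1/48:R) (- 1/48 / (x4 - x1)) (0:R) (0:R) x1 x4 => x2 x2P.
set u := (x2 - x1) / (x4 - x1).
have u01 : 0 < u < 1 by apply: ratio01; lra.
segf ltac:(rewrite /u) (0:R) (u / 24 / (x4 - x2)) (0:R) (0:R) (0:R) x2 x4 => x3 x3P.
set b := (x3 - x2) / (x4 - x2).
have b01 : 0 < b < 1 by apply: ratio01; lra.
segf ltac:(rewrite /b) (0:R) (0:R) (0:R) (b * u / 6) (0:R) (0:R) (1:R) => y4 y4P.
have abd y1 y2 : det (x1, y1) (x2, y2) (x4, y4) =
    (x4 - x1) * (y1 + (y4 - y1) * u - y2).
  by rewrite /det/= /u; field; lra.
have detE y1 y2 y3 : (x3 - x2) * det (x1, y1) (x2, y2) (x4, y4) =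
    (x4 - x2) * det (x1, y1) (x2, y2) (x3, y3) +
    (x2 - x1) * det (x2, y2) (x3, y3) (x4, y4).
  by rewrite /det/=; ring.
(* With b on or above ad, the left side of [detE] is at most 0 while the right side is positive.
   This gives the vanishing outside the ranges of [y1] and [y2]; the heights are read off the goal
   by the matching below. *)
have neg y1 y2 y3 : y1 + (y4 - y1) * u <= y2 ->
    0 < det (x1, y1) (x2, y2) (x3, y3) ->
    0 < det (x2, y2) (x3, y3) (x4, y4) -> False.
  move=> hy2 abc bcd; have := detE y1 y2 y3; rewrite abd.
  have : 0 < (x4 - x2) * det (x1, y1) (x2, y2) (x3, y3) by rewrite mulr_gt0; lra.
  have : 0 < (x2 - x1) * det (x2, y2) (x3, y3) (x4, y4) by rewrite mulr_gt0; lra.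
  have : 0 <= (x3 - x2) * ((x4 - x1) * (y2 - (y1 + (y4 - y1) * u))).
    by rewrite !mulr_ge0; lra.
  lra.
segz ltac:(idtac; match goal with |- context [0 < det ?a ?b ?c] =>
   let r := eval cbn in a.2 in let s := eval cbn in b.2 in
   let t := eval cbn in c.2 in move=> ev; apply: (neg r s t); [nra|lra|lra] end) ltac:(idtac)
  (b * u / 2 * y4 ^+ 2) (- b * u * y4) (b * u / 2) (0:R) (0:R) (0:R) y4 => y1 y1P.
set h := y1 + (y4 - y1) * u.
have h01 : 0 < h < 1 by apply: conv01 => //; lra.
have y1h : y1 < h by rewrite /h ltrDl mulr_gt0; lra.
segz ltac:(idtac; match goal with |- context [0 < det ?a ?b ?c] =>
   let r := eval cbn in a.2 in let s := eval cbn in b.2 in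
   let t := eval cbn in c.2 in move=> ev; apply: (neg r s t); rewrite -?/h; lra end)
  ltac:(rewrite /h) (b * (y4 - y1)) (- b / u) (0:R) (0:R) (0:R) y1 h => y2 y2P.
set lo := y1 + (y2 - y1) * ((x3 - x1) / (x2 - x1)).
set hi := y2 + (y4 - y2) * b.
have lohi : hi - lo = b * (y4 - y1) - b / u * (y2 - y1).
  by rewrite /hi /lo /b /u; field; lra.
have lohi0 : 0 <= hi - lo.
  have -> : hi - lo = b / u * (h - y2) by rewrite lohi /h; field; lra.
  by apply: mulr_ge0; [apply: divr_ge0|]; lra.
have lo0 : 0 <= lo.
  apply: addr_ge0; first lra.
  by apply: mulr_ge0; [lra|apply: divr_ge0; lra].
have hi01 : 0 < hi < 1 by apply: conv01 => //; lra.
have abc y3 : det (x1, y1) (x2, y2) (x3, y3) = (x2 - x1) * (y3 - lo).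
  by rewrite /det/= /lo; field; lra.
have bcd y3 : det (x2, y2) (x3, y3) (x4, y4) = (x4 - x2) * (hi - y3).
  by rewrite /det/= /hi /b; field; lra.
segz ltac:(rewrite abc bcd; nra) ltac:(rewrite lohi) (1:R) (0:R) (0:R) (0:R)
    (0:R) lo hi => y3 y3P.
apply: indic_eq1; last by lra.
by rewrite abc bcd /sorted4/=; nra.
Qed.

(** The ordinates increase in the order b, a, c, d and are integrated outside. At height [y3] the
    chord bd has abscissa [t], strictly between [x2] and [x4]; lying below bd means [t < x3], which
    leaves an interval of length [(x4 - x2) * k]. *)
Lemma integral_inc1324_dip :
  I01 (fun y4 => I01 (fun y2 => I01 (fun y1 => I01 (fun y3 =>
  I01 (fun x4 => I01 (fun x2 => I01 (fun x1 => I01 (fun x3 =>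
   indicator8 inc1324_dip x1 y1 x2 y2 x3 y3 x4 y4)))))))) = (1 / 1728)%:E.
Proof.
rewrite /indicator8 /inc1324_dip.
seg (0:R) (0:R) (0:R) (1/432:R) (0:R) (0:R) (1:R) => y4 y4P.
seg (1/144 * y4 ^+ 2) (- 1/72 * y4) (1/144:R) (0:R) (0:R) (0:R) y4 => y2 y2P.
seg ((y4 - y2) / 48) (- 1/24:R) (1/48 / (y4 - y2)) (0:R) (0:R) y2 y4 => y1 y1P.
seg ((y4 - y1) / 24 / (y4 - y2)) (- 1/24 / (y4 - y2)) (0:R) (0:R) (0:R) y1 y4 => y3 y3P.
set k := (y4 - y3) / (y4 - y2).
segf ltac:(rewrite /k) (0:R) (0:R) (0:R) (k / 6) (0:R) (0:R) (1:R) => x4 x4P.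
seg (0:R) (x4 * k) (- k) (0:R) (0:R) (0:R) x4 => x2 x2P.
seg ((x4 - x2) * k) (0:R) (0:R) (0:R) (0:R) (0:R) x2 => x1 x1P.
set t := x2 + (x4 - x2) * ((y3 - y2) / (y4 - y2)).
have r01 : 0 < (y3 - y2) / (y4 - y2) < 1 by apply: ratio01; lra.
have t01 : 0 < t < 1 by apply: conv01 => //; lra.
have t24 : x2 < t < x4 by rewrite /t; apply/andP; split; nra.
have bcd x3 : det (x2, y2) (x3, y3) (x4, y4) = (y4 - y2) * (x3 - t).
  by rewrite /det/= /t; field; lra.
segz ltac:(rewrite bcd; nra) ltac:(rewrite /t /k) (1:R) (0:R) (0:R) (0:R) (0:R)
    t x4 => x3 x3P.
apply: indic_eq1; last by lra.
by rewrite bcd /sorted4/=; nra.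
Qed.

End events.

(** * Crossings of segments *)

Section geometry.
Context (R : realType).
Implicit Types a b c d z : plane R.

(** The open segment without a parameter, for [a.1 < b.1]: crossings become statements about [det],
    which is affine in z. *)
Definition inseg a b z : Prop := a.1 < z.1 < b.1 /\ det a b z = 0.

Lemma insegP a b z : a.1 < b.1 ->
  inseg a b z <-> exists t : R, 0 < t < 1 /\
    z = ((1 - t) * a.1 + t * b.1, (1 - t) * a.2 + t * b.2).
Proof.
move=> ab; split=> [[/andP[az zb] dz]|[t [/andP[t0 t1] ->]]]; last first.
  by split; [apply/andP; split=> /=; nra|rewrite /det/=; ring].
exists ((z.1 - a.1) / (b.1 - a.1)); split.
  by apply: ratio01; lra.
have zE : z.2 = a.2 + (z.1 - a.1) * (b.2 - a.2) / (b.1 - a.1).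
  apply: (@mulfI _ (b.1 - a.1)); first by lra.
  transitivity ((b.1 - a.1) * a.2 + (z.1 - a.1) * (b.2 - a.2)).
    by move: dz; rewrite /det; lra.
  by field; lra.
apply: injective_projections => /=; last rewrite zE; by field; lra.
Qed.

(** For sorted abscissae the coefficients are positive, so a common sign of [det a b c] and
    [det b c d] is inherited by [det a b d] and, through [det_sub'], by [det a c d]. *)
Lemma det_sub a b c d :
  (c.1 - b.1) * det a b d = (d.1 - b.1) * det a b c + (b.1 - a.1) * det b c d.
Proof. by rewrite /det; ring. Qed.

Lemma det_sub' a b c d :
  (c.1 - b.1) * det a c d = (d.1 - c.1) * det a b c + (c.1 - a.1) * det b c d.
Proof. by rewrite /det; ring. Qed.

Definition cross1324 a b c d : bool :=
  sorted4 a b c d && (0 < det a b c * det b c d).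

Definition cross1423 a b c d : bool :=
  sorted4 a b c d && (det a b d * det a c d < 0).

(** The difference of the heights of the lines ac and bd is affine in the abscissa. Up to positive
    factors it is [det a b c] at b and [- det b c d] at c, so it vanishes strictly between them
    exactly when the two determinants have the same sign. The identity [E] expresses this
    interpolation. *)
Lemma inseg_1324 a b c d : sorted4 a b c d ->
    det a b c != 0 -> det b c d != 0 ->
  (exists z, inseg a c z /\ inseg b d z) <-> 0 < det a b c * det b c d.
Proof.
move=> /and3P[ab bc cd] abc0 bcd0.
have E z : (c.1 - z.1) * (d.1 - b.1) * det a b c
    - (z.1 - b.1) * (c.1 - a.1) * det b c d =
    (c.1 - b.1) * ((c.1 - a.1) * det b d z - (d.1 - b.1) * det a c z).
  by rewrite /det; ring.
split=> [[z [[/andP[az zc] acz] [/andP[bz zd] bdz]]]|pos].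
  have := E z; rewrite acz bdz !mulr0 subr0 mulr0 => {}E.
  set r := (z.1 - b.1) * (c.1 - a.1) / ((c.1 - z.1) * (d.1 - b.1)).
  have r0 : 0 < r by rewrite divr_gt0// mulr_gt0; lra.
  have -> : det a b c = r * det b c d.
    apply: (@mulfI _ ((c.1 - z.1) * (d.1 - b.1))).
      by rewrite mulf_neq0; lra.
    by transitivity ((z.1 - b.1) * (c.1 - a.1) * det b c d);
      [lra|rewrite /r; field; apply/andP; split; lra].
  by rewrite -mulrA mulr_gt0// lt0r sqr_ge0 mulf_neq0.
set A := (d.1 - b.1) * det a b c; set B := (c.1 - a.1) * det b c d.
have AB : 0 < A * B.
  have -> : A * B = (d.1 - b.1) * (c.1 - a.1) * (det a b c * det b c d).
    by rewrite /A /B; ring.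
  by rewrite mulr_gt0// mulr_gt0; lra.
have AB0 : A + B != 0.
  apply/eqP => AB0; have BA : B = - A by lra.
  by move: AB; rewrite BA; nra.
set t := A / (A + B).
(* [A] and [B] have the same sign, positive or negative; squaring the denominator treats both cases
   at once. *)
have tE : t = A * (A + B) / (A + B) ^+ 2 by rewrite /t; field.
have t01 : 0 < t < 1.
  have sq : 0 < (A + B) ^+ 2 by rewrite lt0r sqr_ge0 sqrf_eq0 AB0.
  by rewrite tE divr_gt0//= ?ltr_pdivrMr//; nra.
pose x := b.1 + (c.1 - b.1) * t.
pose z : plane R := (x, a.2 + (x - a.1) * (c.2 - a.2) / (c.1 - a.1)).
have acz : det a c z = 0 by rewrite /det /z/=; field; lra.
have xt : (c.1 - x) * A = (x - b.1) * B.
  by rewrite /x /t; field.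
have bdz : det b d z = 0.
  have := E z; rewrite acz mulr0 subr0 /= => {}E.
  apply: (@mulfI _ ((c.1 - b.1) * (c.1 - a.1))); first by rewrite mulf_neq0; lra.
  by rewrite mulr0 -mulrA -E; move: xt; rewrite /A /B; lra.
have xbc : b.1 < x < c.1 by rewrite /x; apply/andP; split; nra.
by exists z; split; split => //=; lra.
Qed.

(** Over the abscissae of bc the line ad is always present, so the segments meet exactly when b and
    c lie on opposite sides of it; [E] interpolates between the two sides. *)
Lemma inseg_1423 a b c d : sorted4 a b c d ->
    det a b d != 0 -> det a c d != 0 ->
  (exists z, inseg a d z /\ inseg b c z) <-> det a b d * det a c d < 0.
Proof.
move=> /and3P[ab bc cd] abd0 acd0.
have E z : (c.1 - z.1) * det a b d + (z.1 - b.1) * det a c d =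
    (d.1 - a.1) * det b c z - (c.1 - b.1) * det a d z.
  by rewrite /det; ring.
split=> [[z [[/andP[az zd] adz] [/andP[bz zc] bcz]]]|neg].
  have := E z; rewrite adz bcz !mulr0 subr0 => {}E.
  set r := (z.1 - b.1) / (c.1 - z.1).
  have r0 : 0 < r by rewrite divr_gt0//; lra.
  have -> : det a b d = - r * det a c d.
    apply: (@mulfI _ (c.1 - z.1)); first by lra.
    by transitivity (- (z.1 - b.1) * det a c d); [lra|rewrite /r; field; lra].
  by rewrite -mulrA mulNr oppr_lt0 mulr_gt0// lt0r sqr_ge0 mulf_neq0.
set A := det a b d; set B := - det a c d.
have AB : 0 < A * B by rewrite mulrN oppr_gt0.
have AB0 : A + B != 0.
  apply/eqP => AB0; have BA : B = - A by lra.
  by move: AB; rewrite BA; nra.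
set t := A / (A + B).
have tE : t = A * (A + B) / (A + B) ^+ 2 by rewrite /t; field.
have t01 : 0 < t < 1.
  have sq : 0 < (A + B) ^+ 2 by rewrite lt0r sqr_ge0 sqrf_eq0 AB0.
  by rewrite tE divr_gt0//= ?ltr_pdivrMr//; nra.
pose x := b.1 + (c.1 - b.1) * t.
pose z : plane R := (x, b.2 + (x - b.1) * (c.2 - b.2) / (c.1 - b.1)).
have bcz : det b c z = 0 by rewrite /det /z/=; field; lra.
have xt : (c.1 - x) * A = (x - b.1) * B.
  by rewrite /x /t; field.
have adz : det a d z = 0.
  have := E z; rewrite bcz mulr0 sub0r /= => {}E.
  apply: (@mulfI _ (c.1 - b.1)); first by lra.
  by rewrite mulr0; move: xt E; rewrite /A /B; lra.
have xbc : b.1 < x < c.1 by rewrite /x; apply/andP; split; nra.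
by exists z; split; split => //=; lra.
Qed.

(** Together with [inseg_right], this shows that edges sharing a left or a right end do not cross in
    generic position. *)
Lemma inseg_left a b c z : inseg a b z -> inseg a c z -> det a b c = 0.
Proof.
move=> [/andP[az zb] abz] [/andP[_ zc] acz].
have E : (z.1 - a.1) * det a b c =
  (c.1 - a.1) * det a b z - (b.1 - a.1) * det a c z by rewrite /det; ring.
apply: (@mulfI _ (z.1 - a.1)); first by lra.
by rewrite E abz acz; ring.
Qed.

Lemma inseg_right a b c z : inseg a c z -> inseg b c z -> det a b c = 0.
Proof.
move=> [/andP[az zb] acz] [/andP[_ zc] bcz].
have E : (c.1 - z.1) * det a b c =
   (c.1 - a.1) * det b c z - (c.1 - b.1) * det a c z.
  by rewrite /det; ring.
apply: (@mulfI _ (c.1 - z.1)); first by lra.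
by rewrite E acz bcz; ring.
Qed.

End geometry.

(** * Crossings as ordered quadruples of vertices *)

Section counting.
Context (R : realType) (V : finType).
Variable p : V -> plane R.
Implicit Types (e f : {set V}) (i j k l : V).

Definition generic := (forall i j, i != j -> (p i).1 != (p j).1) /\
  (forall i j, i != j -> (p i).2 != (p j).2) /\
  (forall i j k, uniq [:: i; j; k] -> det (p i) (p j) (p k) != 0).

Lemma set2_eq i j k l : [set i; j]%SET = [set k; l]%SET ->
  (i = k /\ j = l) \/ (i = l /\ j = k).
Proof.
move=> E.
have := set21 i j; rewrite E => /set2P[] ik; have := set22 i j;
  rewrite E => /set2P[] jl; [|by left|by right|].
- have := set22 k l; rewrite -E => /set2P[] lE; left; split; congruence.
- have := set21 k l; rewrite -E => /set2P[] lE; right; split; congruence.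
Qed.

Lemma edge_interiorE i j z : (p i).1 < (p j).1 ->
  edge_interior p [set i; j]%SET z <-> inseg (p i) (p j) z.
Proof.
move=> ij; rewrite insegP//; split=> [[i' [j' [t [/set2_eq E t01 ->]]]]|].
  case: E => -[<- <-]; first by exists t.
  exists (1 - t); split; first by lra.
  by congr pair; ring.
by move=> [t [t01 ->]]; exists i, j, t.
Qed.

Lemma crossE i j k l : (p i).1 < (p j).1 -> (p k).1 < (p l).1 ->
  cross p [set i; j]%SET [set k; l]%SET <->
  exists z, inseg (p i) (p j) z /\ inseg (p k) (p l) z.
Proof.
move=> ij kl; split=> -[z]; rewrite /setI/=.
  by case=> /(edge_interiorE _ ij) ? /(edge_interiorE _ kl) ?; exists z.
by case=> ? ?; exists z; split; [exact/edge_interiorE|exact/edge_interiorE].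
Qed.

Lemma crossC e f : cross p e f -> cross p f e.
Proof. by rewrite /cross setIC. Qed.

Lemma chi_slopeE i j : (p i).1 < (p j).1 ->
  chi_slope p [set i; j]%SET = ((p i).2 < (p j).2).
Proof.
move=> ij.
have E : (0 < slope (p i) (p j)) = ((p i).2 < (p j).2).
  by rewrite /slope pmulr_lgt0 ?invr_gt0 ?subr_gt0.
have slopeC : slope (p j) (p i) = slope (p i) (p j).
  by rewrite /slope; field; lra.
rewrite /chi_slope; apply/asboolP/idP => [[i' [j' [/set2_eq]]]|lt2].
  by case=> -[<- <-]; rewrite ?slopeC E.
by exists i, j; rewrite E.
Qed.

Hypothesis gen : generic.

Lemma generic_edge e : #|e| = 2 ->
  exists i j, (p i).1 < (p j).1 /\ e = [set i; j]%SET.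
Proof.
move=> /eqP/cards2P[i [j] [ij ->]]; case: gen => g1 _.
have := g1 _ _ ij; rewrite neq_lt => /orP[lt|lt]; first by exists i, j.
by exists j, i; rewrite finset.setUC.
Qed.

(** The edges are ij and kl, each listed from left to right, the one starting further left being
    first. The relation [S] is trivial for all crossings and equality of colors for monochromatic
    ones. *)
Definition crossing4 (S : {set V} -> {set V} -> Prop) i j k l : bool :=
  (cross1324 (p i) (p k) (p j) (p l) || cross1423 (p i) (p k) (p l) (p j)) &&
  `[< S [set i; j]%SET [set k; l]%SET >].

Let lt_neq i j : (p i).1 < (p j).1 -> i != j.
Proof. by apply: contraTneq => ->; rewrite ltxx. Qed.

Lemma crossing4_cross S i j k l : crossing4 S i j k l ->
  [/\ (p i).1 < (p j).1, (p k).1 < (p l).1, (p i).1 < (p k).1 &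
    cross p [set i; j]%SET [set k; l]%SET /\ S [set i; j]%SET [set k; l]%SET].
Proof.
case: gen => _ [_ g3]; move=> /andP[/orP[] /andP[s4 h] /asboolP Sij].
  have /and3P[a b c] := s4; have ? := lt_trans a b.
  have := lt_neq a; have := lt_neq b; have := lt_neq c.
  have := lt_neq (lt_trans a b); have := lt_neq (lt_trans b c) => bd ac cd bc ab.
  split => //; [exact: lt_trans b c|split => //].
  apply/crossE => //; first exact: lt_trans b c.
  by apply/inseg_1324 => //; apply: g3; rewrite /= !inE ?negb_or ?ab ?bc ?cd ?ac ?bd.
have /and3P[a b c] := s4.
have := lt_neq a; have := lt_neq b; have := lt_neq c.
have := lt_neq (lt_trans a b); have := lt_neq (lt_trans b c).
have := lt_neq (lt_trans a (lt_trans b c)) => ad bd ac cd bc ab.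
have ij := lt_trans a (lt_trans b c).
split => //; split => //.
apply/crossE => //.
by apply/inseg_1423 => //; apply: g3; rewrite /= !inE ?negb_or ?ab ?bc ?cd ?ac ?bd ?ad.
Qed.

Lemma cross_crossing4 (S : {set V} -> {set V} -> Prop) i j k l :
    [set i; j]%SET != [set k; l]%SET ->
    (p i).1 < (p j).1 -> (p k).1 < (p l).1 -> (p i).1 <= (p k).1 ->
    cross p [set i; j]%SET [set k; l]%SET -> S [set i; j]%SET [set k; l]%SET ->
  crossing4 S i j k l.
Proof.
case: gen => g1 [_ g3] ne ij kl ik /crossE [//|//|z [zij zkl]] Sij.
have ik' : (p i).1 < (p k).1.
  rewrite lt_neqAle ik andbT; apply/eqP => E.
  have {}E : i = k by apply: contra_eq E => /g1.
  move: ne kl zkl; rewrite -E => ne il zil.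
  have jl : j != l by apply: contraNneq ne => ->.
  have /eqP := inseg_left zij zil; apply/negP; apply: g3.
  by rewrite /= !inE negb_or (lt_neq ij) (lt_neq il) jl.
have kj : (p k).1 < (p j).1.
  by case: zij => /andP[_ zj] _; case: zkl => /andP[kz _] _; exact: lt_trans kz zj.
apply/andP; split; last exact/asboolP.
have iknj := lt_neq ik'; have kjn := lt_neq kj; have ijn := lt_neq ij.
have kln := lt_neq kl; have iln := lt_neq (lt_trans ik' kl).
(* The right ends decide between the two patterns; a common right end is excluded by
   [inseg_right]. *)
have [jl|jl|E] := ltgtP (p j).1 (p l).1.
- have jln := lt_neq jl.
  rewrite /cross1324 /sorted4 ik' kj jl/=; apply/orP; left.
  apply/inseg_1324; last by exists z.
  + by rewrite /sorted4 ik' kj jl.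
  + by apply: g3; rewrite /= !inE negb_or iknj ijn kjn.
  + by apply: g3; rewrite /= !inE negb_or kjn kln jln.
- have jln := lt_neq jl; rewrite eq_sym in jln.
  rewrite /cross1423 /sorted4 ik' kl jl/=; apply/orP; right.
  apply/inseg_1423; last by exists z.
  + by rewrite /sorted4 ik' kl jl.
  + by apply: g3; rewrite /= !inE negb_or iknj ijn kjn.
  + by apply: g3; rewrite /= !inE negb_or iln ijn eq_sym jln.
- have {}E : j = l by apply: contra_eq E => /g1.
  rewrite -E in zkl kl.
  have /eqP := inseg_right zij zkl => h; exfalso; move: h; apply/negP; apply: g3.
  by rewrite /= !inE negb_or iknj ijn kjn.
Qed.

(** Ordering each edge by abscissa and the two edges by their left ends selects one quadruple per
    unordered pair, so [phi] is injective on crossing quadruples. Symmetry of [S] lets the two edges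
    be swapped. *)
Lemma card_crossing (S : {set V} -> {set V} -> Prop) :
    (forall e f, S e f -> S f e) ->
  #|[set c : {set {set V}} | `[< exists e f, [/\ c = [set e; f]%SET,
     e \in complete_edges V, f \in complete_edges V, e != f &
     cross p e f /\ S e f] >]]%SET| =
  (\sum_i \sum_j \sum_k \sum_l crossing4 S i j k l)%N.
Proof.
move=> SC.
pose phi (t : V * V * V * V) : {set {set V}} :=
  [set [set t.1.1.1; t.1.1.2]; [set t.1.2; t.2]]%SET.
pose B : {set V * V * V * V} :=
  [set t | crossing4 S t.1.1.1 t.1.1.2 t.1.2 t.2]%SET.
transitivity #|phi @: B|; last first.
  rewrite card_in_imset; last first.
    move=> [[[i j] k] l] [[[i' j'] k'] l']; rewrite !inE/= => t t' E.
    have [ij kl ik _] := crossing4_cross t.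
    have [ij' kl' ik' _] := crossing4_cross t'.
    have Eset (a b c d : V) : (p a).1 < (p b).1 -> (p c).1 < (p d).1 ->
        [set a; b]%SET = [set c; d]%SET -> a = c /\ b = d.
      move=> ab cd /set2_eq[//|[ad bc]]; subst.
      by have := lt_trans ab cd; rewrite ltxx.
    have E2 : ([set i; j] = [set i'; j'] /\ [set k; l] = [set k'; l'] \/
               [set i; j] = [set k'; l'] /\ [set k; l] = [set i'; j'])%SET.
      move: E; rewrite /phi/=; move: ([set i; j])%SET ([set k; l])%SET
        ([set i'; j'])%SET ([set k'; l'])%SET => a b c d E.
      have := set21 a b; rewrite E => /set2P[] ac; have := set22 a b;
        rewrite E => /set2P[] bd; [|by left|by right|].
      - have := set22 c d; rewrite -E => /set2P[] dE; left; split; congruence.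
      - have := set21 c d; rewrite -E => /set2P[] dE; right; split; congruence.
    case: E2 => -[/Eset E1 /Eset E2].
      by case: E1 => // -> ->; case: E2 => // -> ->.
    case: E1 => // ? ?; case: E2 => // ? ?; subst.
    by have := lt_trans ik ik'; rewrite ltxx.
  rewrite -sum1dep_card !pair_big/= [LHS]big_mkcond/=.
  by apply: eq_bigr => t _; case: (crossing4 _ _ _ _ _).
apply: eq_card => c; rewrite inE; apply/asboolP/imsetP.
  move=> [e [f [-> ]]]; rewrite !inE => /eqP e2 /eqP f2 ef [cef Sef].
  have [i [j [ij eE]]] := generic_edge e2; have [k [l [kl fE]]] := generic_edge f2.
  have [ik|ki] := leP (p i).1 (p k).1.
    exists (i, j, k, l); last by rewrite /phi/= -eE -fE.
    by rewrite inE/=; apply: cross_crossing4; rewrite -?eE -?fE.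
  exists (k, l, i, j); last by rewrite /phi/= -eE -fE finset.setUC.
  rewrite inE/=; apply: cross_crossing4; rewrite -?eE -?fE//; last exact: SC.
  - by rewrite eq_sym.
  - exact: ltW.
  - exact: crossC.
move=> [[[[i j] k] l]]; rewrite inE/= => t ->.
have [ij kl ik [? ?]] := crossing4_cross t.
exists [set i; j]%SET, [set k; l]%SET; split => //.
- by rewrite inE cards2 (lt_neq ij).
- by rewrite inE cards2 (lt_neq kl).
- apply/eqP => /set2_eq[[E _]|[E1 E2]]; subst; first by rewrite ltxx in ik.
  by have := lt_trans kl ik; rewrite ltxx.
Qed.

End counting.

(** * Reflections of the square *)

Section reflections.
Context (R : realType).
Implicit Types a b c d z : plane R.

(* The reflection across x = 1/2 if [s], then the one across y = 1/2 if [t]. *)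
Definition reflect2 (s t : bool) a : plane R :=
  (if s then 1 - a.1 else a.1, if t then 1 - a.2 else a.2).

(* Reflections in x reverse the left-to-right order of the points. *)
Definition reflected (s t : bool) (e : plane R -> plane R -> plane R -> plane R -> bool)
    a b c d : bool :=
  let r := reflect2 s t in
  if s then e (r d) (r c) (r b) (r a) else e (r a) (r b) (r c) (r d).

Let sorted_refl s t a b c d : reflected s t (@sorted4 R) a b c d = sorted4 a b c d.
Proof.
rewrite /reflected /sorted4; case: s => //=.
rewrite !ltrD2l !ltrN2.
by case: (a.1 < b.1); case: (b.1 < c.1); case: (c.1 < d.1).
Qed.

Let det_y a b c :
  det (reflect2 false true a) (reflect2 false true b) (reflect2 false true c) =
  - det a b c.
Proof. by rewrite /det/=; ring. Qed.

Let det_xy a b c :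
  det (reflect2 true true c) (reflect2 true true b) (reflect2 true true a) =
  - det a b c.
Proof. by rewrite /det/=; ring. Qed.

Let det_x a b c :
  det (reflect2 true false c) (reflect2 true false b) (reflect2 true false a) =
  det a b c.
Proof. by rewrite /det/=; ring. Qed.

Let ltr0_sgn (x : R) : x != 0 -> (x < 0) = ~~ (0 < x).
Proof. by move=> x0; rewrite -leNgt le_eqVlt (negbTE x0). Qed.

Let mulr_gt0_sgn (x y : R) : x != 0 -> y != 0 -> (0 < x * y) = ((0 < x) == (0 < y)).
Proof.
move=> x0 y0; have [x1|x1] := ltP 0 x; first by rewrite pmulr_rgt0.
have {}x1 : x < 0 by rewrite lt_neqAle x0.
by rewrite nmulr_rgt0// ltr0_sgn//; case: (0 < y).
Qed.

Let mulr_lt0_sgn (x y : R) : x != 0 -> y != 0 -> (x * y < 0) = ((0 < x) != (0 < y)).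
Proof.
by move=> x0 y0; rewrite -mulr_gt0_sgn// ltr0_sgn// mulf_neq0.
Qed.

(* b or c lies in the triangle of the other three points in one of four ways, which
   are mirror images of each other; otherwise exactly one crossing occurs. *)
Lemma conv_partition a b c d :
    (sorted4 a b c d -> [/\ det a b c != 0, det a b d != 0, det a c d != 0 &
      det b c d != 0]) ->
  (cross1324 a b c d + cross1423 a b c d + inner_second a b c d
   + reflected false true (@inner_second R) a b c d
   + reflected true true (@inner_second R) a b c d
   + reflected true false (@inner_second R) a b c d
   = sorted4 a b c d)%N.
Proof.
have E s t := sorted_refl s t a b c d.
rewrite /cross1324 /cross1423 /reflected /inner_second.
have := E true true; have := E true false; have := E false true.
rewrite /reflected => -> -> ->.
case: (boolP (sorted4 a b c d)) => // /and3P[ab bc cd] /(_ isT)[abc abd acd bcd].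
rewrite !det_y !det_xy !det_x !oppr_gt0 !oppr_lt0.
rewrite !mulr_gt0_sgn// !mulr_lt0_sgn// !ltr0_sgn//.
(* Of the 16 sign patterns of the four determinants, [pos] and [neg] leave ten: two give ac x bd,
   four give ad x bc, and each mirror image of [inner_second] accounts for one. *)
have pos : (0 < det a b c) && (0 < det b c d) ->
    (0 < det a b d) && (0 < det a c d).
  move=> /andP[h1 h2]; apply/andP; split.
    have : 0 < (c.1 - b.1) * det a b d.
      by rewrite det_sub addr_gt0// mulr_gt0; lra.
    by rewrite pmulr_rgt0//; lra.
  have : 0 < (c.1 - b.1) * det a c d.
    by rewrite det_sub' addr_gt0// mulr_gt0; lra.
  by rewrite pmulr_rgt0//; lra.
have neg : ~~ (0 < det a b c) && ~~ (0 < det b c d) ->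
    ~~ (0 < det a b d) && ~~ (0 < det a c d).
  rewrite -!ltr0_sgn// => /andP[h1 h2]; apply/andP; split.
    have : (c.1 - b.1) * det a b d < 0.
      rewrite det_sub -oppr_gt0 opprD -!mulrN.
      by rewrite addr_gt0// mulr_gt0; lra.
    by rewrite pmulr_rlt0//; lra.
  have : (c.1 - b.1) * det a c d < 0.
    rewrite det_sub' -oppr_gt0 opprD -!mulrN.
    by rewrite addr_gt0// mulr_gt0; lra.
  by rewrite pmulr_rlt0//; lra.
move/implyP: pos; move/implyP: neg.
by move: (0 < det a b c) (0 < det a b d) (0 < det a c d) (0 < det b c d)
  => [] [] [] [].
Qed.

Let lt_sgn (x y : R) : x != y -> (y < x) = ~~ (x < y).
Proof. by move=> xy; rewrite -leNgt le_eqVlt eq_sym (negbTE xy). Qed.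

(** The four reflections realize the four combinations of the common sign of the determinants with
    the common sign of the slopes. It remains to split a convex chain abcd whose edges ac and bd
    have positive slope: b is above a ([inc1324_cup]) or below it ([inc1324_dip]). *)
Lemma mono1324_partition a b c d :
    (sorted4 a b c d -> [/\ det a b c != 0 & det b c d != 0]) ->
    (sorted4 a b c d ->
      [/\ a.2 != b.2, a.2 != c.2, b.2 != c.2, b.2 != d.2 & c.2 != d.2]) ->
  ((cross1324 a b c d && ((a.2 < c.2) == (b.2 < d.2)))%R =
   inc1324_cup a b c d + reflected false true (@inc1324_cup R) a b c d +
   (reflected true true (@inc1324_cup R) a b c d +
    reflected true false (@inc1324_cup R) a b c d) +
   (inc1324_dip a b c d + reflected false true (@inc1324_dip R) a b c d +
   (reflected true true (@inc1324_dip R) a b c d +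
    reflected true false (@inc1324_dip R) a b c d)) :> nat)%N.
Proof.
have E s t := sorted_refl s t a b c d.
rewrite /cross1324 /reflected /inc1324_cup /inc1324_dip.
have := E true true; have := E true false; have := E false true.
rewrite /reflected => -> -> ->.
case: (boolP (sorted4 a b c d)) => // /and3P[ab bc cd].
move=> /(_ isT)[abc bcd] /(_ isT)[yab yac ybc ybd ycd].
rewrite !det_y !det_xy !det_x !oppr_gt0 /= !ltrD2l !ltrN2.
rewrite !mulr_gt0_sgn// !ltr0_sgn//.
(* The facts [h1] to [h8] relate turns to comparisons of heights, [t1] to [t4] are transitivity;
   from them the identity is a Boolean check. *)
have h1 : [&& b.2 < a.2 & a.2 < c.2] -> 0 < det a b c.
  by rewrite /det => /andP[? ?]; nra.
have h2 : [&& a.2 < b.2 & c.2 < a.2] -> det a b c < 0.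
  by rewrite /det => /andP[? ?]; nra.
have h3 : [&& c.2 < d.2 & d.2 < b.2] -> 0 < det b c d.
  by rewrite /det => /andP[? ?]; nra.
have h4 : [&& d.2 < c.2 & b.2 < d.2] -> det b c d < 0.
  by rewrite /det => /andP[? ?]; nra.
have h5 : [&& 0 < det a b c & a.2 < b.2] -> b.2 < c.2.
  by rewrite /det => /andP[? ?]; nra.
have h6 : [&& 0 < det b c d & b.2 < c.2] -> c.2 < d.2.
  by rewrite /det => /andP[? ?]; nra.
have h7 : [&& det a b c < 0 & b.2 < a.2] -> c.2 < b.2.
  by rewrite /det => /andP[? ?]; nra.
have h8 : [&& det b c d < 0 & c.2 < b.2] -> d.2 < c.2.
  by rewrite /det => /andP[? ?]; nra.
have t1 : [&& a.2 < b.2 & b.2 < c.2] -> a.2 < c.2.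
  by move=> /andP[]; exact: lt_trans.
have t2 : [&& b.2 < a.2 & c.2 < b.2] -> c.2 < a.2.
  by move=> /andP[xx yy]; exact: lt_trans yy xx.
have t3 : [&& b.2 < c.2 & c.2 < d.2] -> b.2 < d.2.
  by move=> /andP[]; exact: lt_trans.
have t4 : [&& c.2 < b.2 & d.2 < c.2] -> d.2 < b.2.
  by move=> /andP[xx yy]; exact: lt_trans yy xx.
move/implyP: h1; move/implyP: h2; move/implyP: h3; move/implyP: h4.
move/implyP: h5; move/implyP: h6; move/implyP: h7; move/implyP: h8.
move/implyP: t1; move/implyP: t2; move/implyP: t3; move/implyP: t4.
rewrite !(lt_sgn yab) !(lt_sgn yac) !(lt_sgn ybc) !(lt_sgn ybd) !(lt_sgn ycd).
rewrite !(ltr0_sgn abc) !(ltr0_sgn bcd).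
by move: (0 < det a b c) (0 < det b c d) (a.2 < b.2) (b.2 < c.2) (c.2 < d.2)
  (a.2 < c.2) (b.2 < d.2) => [] [] [] [] [] [] [].
Qed.

(** [inc1423_above] and [inc1423_below] already cover both sides of ad on which b can lie, so only
    the reflection exchanging positive and negative slopes is added. *)
Lemma mono1423_partition a b c d :
    (sorted4 a b c d -> [/\ det a b d != 0 & det a c d != 0]) ->
    (sorted4 a b c d -> [/\ a.2 != d.2 & b.2 != c.2]) ->
  ((cross1423 a b c d && ((a.2 < d.2) == (b.2 < c.2)))%R =
   inc1423_above a b c d + reflected false true (@inc1423_above R) a b c d +
   (inc1423_below a b c d + reflected false true (@inc1423_below R) a b c d) :> nat)%N.
Proof.
have E s t := sorted_refl s t a b c d.
rewrite /cross1423 /reflected /inc1423_above /inc1423_below.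
have := E false true.
rewrite /reflected => ->.
case: (boolP (sorted4 a b c d)) => // /and3P[ab bc cd].
move=> /(_ isT)[abd acd] /(_ isT)[yad ybc].
rewrite !det_y !oppr_gt0 !oppr_lt0 /= !ltrD2l !ltrN2.
rewrite !mulr_lt0_sgn// !ltr0_sgn//.
(* When b is below ad and c above it, bc is steeper than ad; this is why [inc1423_below] does not
   compare the heights of b and c. *)
have E1 : (d.1 - a.1) * (c.2 - b.2) = det a c d * - 1 + det a b d
    + (c.1 - b.1) * (d.2 - a.2) by rewrite /det; ring.
have h1 : [&& a.2 < d.2, 0 < det a b d & det a c d < 0] -> b.2 < c.2.
  move=> /and3P[x1 x2 x3].
  have : 0 < (d.1 - a.1) * (c.2 - b.2).
    by rewrite E1; have : 0 < (c.1 - b.1) * (d.2 - a.2) by [rewrite mulr_gt0; lra]; lra.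
  by rewrite pmulr_rgt0; lra.
have h2 : [&& d.2 < a.2, det a b d < 0 & 0 < det a c d] -> c.2 < b.2.
  move=> /and3P[x1 x2 x3].
  have : (d.1 - a.1) * (c.2 - b.2) < 0.
    rewrite E1; have : 0 < (c.1 - b.1) * (a.2 - d.2) by rewrite mulr_gt0; lra.
    by lra.
  by rewrite pmulr_rlt0; lra.
move/implyP: h1; move/implyP: h2; rewrite !(lt_sgn yad) !(lt_sgn ybc) !(ltr0_sgn abd) !(ltr0_sgn acd).
by case: (0 < det a b d); case: (0 < det a c d); case: (a.2 < d.2);
  case: (b.2 < c.2).
Qed.

End reflections.

(** * Almost sure events *)

Section integral_off_null.
Context d (T : measurableType d) (R : realType) (mu : {measure set T -> \bar R}).
Import HBNNSimple.

Let le_integral_off_null (N : set T) (f g : T -> \bar R) :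
  measurable N -> mu N = 0%E -> (forall x, 0 <= f x)%E -> (forall x, 0 <= g x)%E ->
  (forall x, ~ N x -> f x = g x) -> (\int[mu]_x f x <= \int[mu]_x g x)%E.
Proof.
move=> mN N0 f0 g0 fg; rewrite [leLHS]ge0_integralTE// [leRHS]ge0_integralTE//.
apply: ge_ereal_sup => _ [h hf <-].
have mNC : measurable (~` N) by exact: measurableC.
pose h' := proj_nnsfun h mNC.
have h'E x : h' x = h x * \1_(~` N) x by [].
have -> : sintegral mu h = sintegral mu h'.
  have E (k : {nnsfun T >-> R}) : sintegral mu k = (\int[mu]_x (k x)%:E)%E.
    by rewrite integral_nnsfun// patch_setT.
  rewrite !E; apply: ae_eq_integral => //.
  - by apply: measurableT_comp.
  - by apply: measurableT_comp.
  exists N; split => // x hx; apply: contrapT => Nx; apply: hx => _.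
  by congr EFin; apply: etrans (esym (h'E x)); rewrite indicE mem_set// mulr1.
apply: ereal_sup_ubound; exists h' => // x.
rewrite (_ : h' x = h x * \1_(~` N) x)// indicE; have [xN|xN] := boolP (x \in ~` N).
  by rewrite mulr1; move: xN; rewrite inE => xN; rewrite -fg//; exact: hf.
by rewrite mulr0.
Qed.

(* [f] may fail to be measurable, as the number of crossings may on degenerate
   configurations: its integral is a supremum over the simple functions below it,
   and changing those on a null set does not affect their integrals. *)
Lemma ge0_ae_eq_integral_nonmeasurable (f g : T -> \bar R) :
  (forall x, 0 <= f x)%E -> (forall x, 0 <= g x)%E ->
  {ae mu, forall x, f x = g x} -> (\int[mu]_x f x = \int[mu]_x g x)%E.
Proof.
move=> f0 g0 [N [mN N0 fgN]].
have fg x : ~ N x -> f x = g x by move=> Nx; apply: contrapT => /fgN.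
apply/eqP; rewrite eq_le (le_integral_off_null mN N0 f0 g0 fg)/=.
by apply: (le_integral_off_null mN N0 g0 f0) => x /fg.
Qed.

End integral_off_null.

(** * Invariance of the uniform law under reflections *)

Section reflection_law.
Context (R : realType).
Local Notation RR := (measurableTypeR R).

Let flip (x : RR) : RR := 1 - x.

Let mflip : measurable_fun setT flip.
Proof. exact: measurable_funB. Qed.

Lemma measurable_flip (A : set RR) : measurable A ->
  measurable ((fun x => 1 - x) @^-1` A).
Proof. by move=> mA; rewrite -[X in measurable X]setTI; exact: mflip. Qed.

Let lebesgue_flip (A : set RR) : measurable A ->
  lebesgue_measure (flip @^-1` A) = lebesgue_measure A.
Proof.
move=> mA; apply/esym.
pose m : {measure set RR -> \bar R} :=
  pushforward lebesgue_measure flip.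
apply: (@lebesgue_measure_unique R (m mflip)) => // _ [[a b] /= ab <-].
(* The reflection exchanges the open and the closed end, which leaves the length unchanged. *)
have -> : m mflip `]a, b]%classic = @lebesgue_measure R `[1 - b, 1 - a[%classic.
  rewrite /m /= /pushforward; congr lebesgue_measure; apply/seteqP.
  by split=> x /=; rewrite !in_itv/= /flip => ?; lra.
rewrite !lebesgue_measure_itv/= !lte_fin ltrD2l ltrN2.
by case: ifP => // _; rewrite -!EFinB; congr (_%:E); ring.
Qed.

Lemma lambda01_flip (A : set RR) : measurable A ->
  lambda01 R ((fun x => 1 - x) @^-1` A) = lambda01 R A.
Proof.
move=> mA; rewrite -[X in lambda01 R X]/(flip @^-1` A) !lambda01E//;
  last exact: measurable_flip.
rewrite -[RHS]lebesgue_flip; last by apply: measurableI => //; exact: measurable_itv.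
congr lebesgue_measure; apply/seteqP.
by split=> x /= [? h]; split => //; move: h; rewrite !in_itv/= /flip; lra.
Qed.

End reflection_law.

Section points.
Context d (T : measurableType d) (R : realType) (P : probability T R) (n : nat).
Local Notation RR := (measurableTypeR R).
Local Notation K := ('I_n * bool)%type.
Implicit Types Z : K -> T -> RR.

Definition point Z (i : 'I_n) (w : T) : plane R := (Z (i, false) w, Z (i, true) w).

Definition reflectZ (s t : bool) Z (k : K) (w : T) : RR :=
  if (if k.2 then t else s) then 1 - Z k w else Z k w.

(** The points built from [reflectZ s t Z] are by conversion the images under [reflect2 s t] of
    those built from [Z]; hence a reflected event has the probability of the original one. *)
Lemma indep_uniform_reflect s t Z :
  indep_uniform P Z -> indep_uniform P (reflectZ s t Z).
Proof.
move=> [mZ ZE]; split=> [k|A mA].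
  rewrite /reflectZ; case: (if k.2 then t else s); last exact: mZ.
  by apply: measurable_funB => //; exact: mZ.
pose A' (k : K) : set RR :=
  if (if k.2 then t else s) then (fun x => 1 - x) @^-1` A k else A k.
have mA' k : measurable (A' k).
  rewrite /A'; case: (if k.2 then t else s); last exact: mA.
  exact: measurable_flip.
transitivity (P (\bigcap_k (Z k @^-1` A' k))).
  congr (P _); apply: eq_bigcapr => k _; apply/seteqP; rewrite /reflectZ /A'.
  by case: (if k.2 then t else s); split.
rewrite ZE//; apply: eq_bigr => k _; rewrite /A'.
by case: (if k.2 then t else s) => //; exact: lambda01_flip.
Qed.

End points.

Section projections.
Context d1 d2 d3 (S : measurableType d1) (A : measurableType d2)
  (B : measurableType d3) (f : S -> A * B).

Lemma measurable_fun_fst : measurable_fun setT f ->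
  measurable_fun setT (fun s => (f s).1).
Proof. exact: (measurableT_comp measurable_fst). Qed.

Lemma measurable_fun_snd : measurable_fun setT f ->
  measurable_fun setT (fun s => (f s).2).
Proof. exact: (measurableT_comp measurable_snd). Qed.

End projections.

Ltac mproj := lazymatch goal with
  | |- measurable_fun _ (fun z => (_, _)) => apply: measurable_fun_pair; mproj
  | |- measurable_fun _ (fun z => z) => exact: measurable_id
  | |- measurable_fun _ (fun z => fst _) => apply: measurable_fun_fst; mproj
  | |- measurable_fun _ (fun z => snd _) => apply: measurable_fun_snd; mproj
  | |- measurable_fun _ fst => exact: measurable_fst
  | |- measurable_fun _ snd => exact: measurable_snd
  end.

(** * Measurability of the events *)

Section measurable_events.
Context (R : realType).
Local Notation RR := (measurableTypeR R).
Lemma measurable_det d (S : measurableType d) (a b c : S -> plane R) :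
    measurable_fun setT a -> measurable_fun setT b -> measurable_fun setT c ->
  measurable_fun setT (fun s => det (a s) (b s) (c s)).
Proof.
move=> ma mb mc; rewrite /det.
by apply: measurable_funB; apply: measurable_funM; apply: measurable_funB;
  (apply: (measurableT_comp measurable_fst) || apply: (measurableT_comp measurable_snd)).
Qed.

Section functions.
Context d (S : measurableType d) (a b c f : S -> plane R).
Hypotheses (ma : measurable_fun setT a) (mb : measurable_fun setT b).
Hypotheses (mc : measurable_fun setT c) (mf : measurable_fun setT f).

Lemma measurable_lt_fst : measurable_fun setT (fun s => (a s).1 < (b s).1).
Proof.
apply: measurable_fun_ltr.
  exact: (measurableT_comp measurable_fst ma).
exact: (measurableT_comp measurable_fst mb).
Qed.

Lemma measurable_lt_snd : measurable_fun setT (fun s => (a s).2 < (b s).2).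
Proof.
apply: measurable_fun_ltr.
  exact: (measurableT_comp measurable_snd ma).
exact: (measurableT_comp measurable_snd mb).
Qed.

Lemma measurable_det_gt0 :
  measurable_fun setT (fun s => 0 < det (a s) (b s) (c s)).
Proof. by apply: measurable_fun_ltr => //; exact: measurable_det. Qed.

Lemma measurable_det_lt0 :
  measurable_fun setT (fun s => det (a s) (b s) (c s) < 0).
Proof. by apply: measurable_fun_ltr => //; exact: measurable_det. Qed.

End functions.

Section events.
Context d (S : measurableType d) (a b c f : S -> plane R).
Hypotheses (ma : measurable_fun setT a) (mb : measurable_fun setT b).
Hypotheses (mc : measurable_fun setT c) (mf : measurable_fun setT f).

Lemma measurable_sorted4 :
  measurable_fun setT (fun s => sorted4 (a s) (b s) (c s) (f s)).
Proof.
apply: measurable_and; first exact: measurable_lt_fst.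
by apply: measurable_and; exact: measurable_lt_fst.
Qed.

Lemma measurable_inner_second :
  measurable_fun setT (fun s => inner_second (a s) (b s) (c s) (f s)).
Proof.
apply: measurable_and; first exact: measurable_sorted4.
apply: measurable_and; first exact: measurable_det_gt0.
apply: measurable_and; first exact: measurable_det_lt0.
exact: measurable_det_gt0.
Qed.

Lemma measurable_inc1423_above :
  measurable_fun setT (fun s => inc1423_above (a s) (b s) (c s) (f s)).
Proof.
apply: measurable_and; first exact: measurable_sorted4.
apply: measurable_and; first exact: measurable_lt_snd.
apply: measurable_and; first exact: measurable_det_lt0.
apply: measurable_and; first exact: measurable_det_gt0.
exact: measurable_lt_snd.
Qed.

Lemma measurable_inc1423_below :
  measurable_fun setT (fun s => inc1423_below (a s) (b s) (c s) (f s)).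
Proof.
apply: measurable_and; first exact: measurable_sorted4.
apply: measurable_and; first exact: measurable_lt_snd.
apply: measurable_and; first exact: measurable_det_gt0.
exact: measurable_det_lt0.
Qed.

Lemma measurable_inc1324_cup :
  measurable_fun setT (fun s => inc1324_cup (a s) (b s) (c s) (f s)).
Proof.
apply: measurable_and; first exact: measurable_sorted4.
apply: measurable_and; first exact: measurable_lt_snd.
apply: measurable_and; first exact: measurable_det_gt0.
exact: measurable_det_gt0.
Qed.

Lemma measurable_inc1324_dip :
  measurable_fun setT (fun s => inc1324_dip (a s) (b s) (c s) (f s)).
Proof.
apply: measurable_and; first exact: measurable_sorted4.
apply: measurable_and; first exact: measurable_lt_snd.
apply: measurable_and; first exact: measurable_lt_snd.
apply: measurable_and; first exact: measurable_lt_snd.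
exact: measurable_det_gt0.
Qed.

Lemma measurable_cross1324 :
  measurable_fun setT (fun s => cross1324 (a s) (b s) (c s) (f s)).
Proof.
apply: measurable_and; first exact: measurable_sorted4.
by apply: measurable_fun_ltr => //; apply: measurable_funM; exact: measurable_det.
Qed.

Lemma measurable_cross1423 :
  measurable_fun setT (fun s => cross1423 (a s) (b s) (c s) (f s)).
Proof.
apply: measurable_and; first exact: measurable_sorted4.
by apply: measurable_fun_ltr => //; apply: measurable_funM; exact: measurable_det.
Qed.

End events.

End measurable_events.

(** * Probabilities as iterated integrals *)

Section event_probabilities.
Context d (T : measurableType d) (R : realType) (P : probability T R) (n : nat).
Local Notation RR := (measurableTypeR R).
Local Notation event4 := (plane R -> plane R -> plane R -> plane R -> bool).
Local Notation K := ('I_n * bool)%type.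

(** Quantifying over [Z] and over all distinct indices allows use with reflected coordinates and
    with the four points in reverse order. *)
Definition has_prob4 (e : event4) (v : R) := forall (Z : K -> T -> RR),
  indep_uniform P Z -> forall i j k l : 'I_n, uniq [:: i; j; k; l] ->
  P [set w | e (point Z i w) (point Z j w) (point Z k w) (point Z l w)] = v%:E.

Lemma measurable_point (Z : K -> T -> RR) i : indep_uniform P Z ->
  measurable_fun setT (point Z i).
Proof. by case=> mZ _; apply: measurable_fun_pair. Qed.

Local Notation RR8 := (RR * (RR * (RR * (RR * (RR * (RR * (RR * RR)))))))%type.

Let mq1 : measurable_fun [set: RR8] (fun z => z.1).
Proof. by exact: measurable_fst. Qed.

Let mq2 : measurable_fun [set: RR8] (fun z => z.2.1).
Proof. by apply: measurable_fun_fst; exact: measurable_snd. Qed.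

Let mq3 : measurable_fun [set: RR8] (fun z => z.2.2.1).
Proof.
by apply: measurable_fun_fst; do 1! apply: measurable_fun_snd; exact: measurable_snd. Qed.

Let mq4 : measurable_fun [set: RR8] (fun z => z.2.2.2.1).
Proof.
by apply: measurable_fun_fst; do 2! apply: measurable_fun_snd; exact: measurable_snd. Qed.

Let mq5 : measurable_fun [set: RR8] (fun z => z.2.2.2.2.1).
Proof.
by apply: measurable_fun_fst; do 3! apply: measurable_fun_snd; exact: measurable_snd. Qed.

Let mq6 : measurable_fun [set: RR8] (fun z => z.2.2.2.2.2.1).
Proof.
by apply: measurable_fun_fst; do 4! apply: measurable_fun_snd; exact: measurable_snd. Qed.

Let mq7 : measurable_fun [set: RR8] (fun z => z.2.2.2.2.2.2.1).
Proof.
by apply: measurable_fun_fst; do 5! apply: measurable_fun_snd; exact: measurable_snd. Qed.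

Let mq8 : measurable_fun [set: RR8] (fun z => z.2.2.2.2.2.2.2).
Proof. by do 6! apply: measurable_fun_snd; exact: measurable_snd. Qed.

(** The four lists are the orders of integration used above; [false] marks abscissae and [true]
    ordinates. *)
Let uniq_coords (i j k l : 'I_n) : uniq [:: i; j; k; l] ->
  [/\ uniq [:: (l, false); (k, false); (j, false); (i, false);
       (i, true); (j, true); (k, true); (l, true)],
      uniq [:: (l, false); (i, false); (k, false); (j, false);
       (l, true); (i, true); (k, true); (j, true)],
      uniq [:: (l, false); (i, false); (j, false); (k, false);
       (l, true); (i, true); (j, true); (k, true)] &
      uniq [:: (l, true); (j, true); (i, true); (k, true);
       (l, false); (j, false); (i, false); (k, false)] ].
Proof.
rewrite /= !inE !negb_or !xpair_eqE /= ?andbT ?andbF/=.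
rewrite (eq_sym j i) (eq_sym k i) (eq_sym l i) (eq_sym k j) (eq_sym l j) (eq_sym l k).
by case: (i == j); case: (i == k); case: (i == l); case: (j == k);
  case: (j == l); case: (k == l) => //=.
Qed.

Lemma prob_sorted4 : has_prob4 (@sorted4 R) (1 / 24).
Proof.
move=> Z ZU i j k l /uniq_coords[u _ _ _].
rewrite -(integral_sorted4 R).
apply: (prob_iterated8 ZU (e := fun z => sorted4 (z.2.2.2.1, z.2.2.2.2.1)
  (z.2.2.1, z.2.2.2.2.2.1) (z.2.1, z.2.2.2.2.2.2.1) (z.1, z.2.2.2.2.2.2.2)) u).
by apply: measurable_sorted4; apply: measurable_fun_pair.
Qed.

Lemma prob_inner_second : has_prob4 (@inner_second R) (11 / 3456).
Proof.
move=> Z ZU i j k l /uniq_coords[_ u _ _].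
rewrite -(integral_inner_second R).
apply: (prob_iterated8 ZU (e := fun z => inner_second (z.2.1, z.2.2.2.2.2.1)
  (z.2.2.2.1, z.2.2.2.2.2.2.2) (z.2.2.1, z.2.2.2.2.2.2.1) (z.1, z.2.2.2.2.1)) u).
by apply: measurable_inner_second; apply: measurable_fun_pair.
Qed.

Lemma prob_inc1423_above : has_prob4 (@inc1423_above R) (1 / 3456).
Proof.
move=> Z ZU i j k l /uniq_coords[_ u _ _].
rewrite -(integral_inc1423_above R).
apply: (prob_iterated8 ZU (e := fun z => inc1423_above (z.2.1, z.2.2.2.2.2.1)
  (z.2.2.2.1, z.2.2.2.2.2.2.2) (z.2.2.1, z.2.2.2.2.2.2.1) (z.1, z.2.2.2.2.1)) u).
by apply: measurable_inc1423_above; apply: measurable_fun_pair.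
Qed.

Lemma prob_inc1423_below : has_prob4 (@inc1423_below R) (11 / 3456).
Proof.
move=> Z ZU i j k l /uniq_coords[_ u _ _].
rewrite -(integral_inc1423_below R).
apply: (prob_iterated8 ZU (e := fun z => inc1423_below (z.2.1, z.2.2.2.2.2.1)
  (z.2.2.2.1, z.2.2.2.2.2.2.2) (z.2.2.1, z.2.2.2.2.2.2.1) (z.1, z.2.2.2.2.1)) u).
by apply: measurable_inc1423_below; apply: measurable_fun_pair.
Qed.

Lemma prob_inc1324_cup : has_prob4 (@inc1324_cup R) (1 / 3456).
Proof.
move=> Z ZU i j k l /uniq_coords[_ _ u _].
rewrite -(integral_inc1324_cup R).
apply: (prob_iterated8 ZU (e := fun z => inc1324_cup (z.2.1, z.2.2.2.2.2.1)
  (z.2.2.1, z.2.2.2.2.2.2.1) (z.2.2.2.1, z.2.2.2.2.2.2.2) (z.1, z.2.2.2.2.1)) u).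
by apply: measurable_inc1324_cup; apply: measurable_fun_pair.
Qed.

Lemma prob_inc1324_dip : has_prob4 (@inc1324_dip R) (1 / 1728).
Proof.
move=> Z ZU i j k l /uniq_coords[_ _ _ u].
rewrite -(integral_inc1324_dip R).
apply: (prob_iterated8 ZU (e := fun z => inc1324_dip (z.2.2.2.2.2.2.1, z.2.2.1)
  (z.2.2.2.2.2.1, z.2.1) (z.2.2.2.2.2.2.2, z.2.2.2.1) (z.2.2.2.2.1, z.1)) u).
by apply: measurable_inc1324_dip; apply: measurable_fun_pair.
Qed.

End event_probabilities.

(** * Almost sure general position *)

Section generic.
Context d (T : measurableType d) (R : realType) (P : probability T R) (n : nat).
Local Notation RR := (measurableTypeR R).
Local Notation K := ('I_n * bool)%type.

Lemma ae_generic (Z : K -> T -> RR) : indep_uniform P Z ->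
  {ae P, forall w, generic (fun i => point Z i w)}.
Proof.
move=> ZU; have mZ := proj1 ZU.
have coord (k1 k2 : K) : k1 != k2 -> {ae P, forall w, Z k1 w != Z k2 w}.
  move=> k12; exists [set w | Z k1 w == Z k2 w]; split.
  - by apply: measurable_pred; apply: measurable_fun_eqr; exact: mZ.
  - have u : uniq [:: k1; k2] by rewrite /= inE k12.
    apply: etrans (prob_iterated2 ZU (e := fun z => z.1 == z.2) u _) _.
      by apply: measurable_fun_eqr.
    apply: I01_eq0 => z1 _; apply: (@I01_point _ z1) => z2 _ /=.
    by rewrite eq_sym => /negbTE ->.
  - by move=> w /= /negP; rewrite negbK.
(* Collinearity fixes the third ordinate only when the first two abscissae differ; equal abscissae
   are excluded by [coord]. *)
have dets (i j k : 'I_n) : uniq [:: i; j; k] ->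
    {ae P, forall w, (Z (i, false) w != Z (j, false) w) ==>
       (det (point Z i w) (point Z j w) (point Z k w) != 0)}.
  move=> ijk.
  pose b (w : T) := (Z (i, false) w != Z (j, false) w) &&
    (det (point Z i w) (point Z j w) (point Z k w) == 0).
  exists [set w | b w]; split.
  - apply: measurable_pred; apply: measurable_and.
      by apply: measurable_neg; apply: measurable_fun_eqr; exact: mZ.
    apply: measurable_fun_eqr => //.
    by apply: measurable_det; exact: (measurable_point _ ZU).
  - have u : uniq [:: (i, false); (j, false); (k, false); (i, true); (j, true); (k, true)].
      move: ijk; rewrite /= !inE !negb_or !xpair_eqE /= !andbT !andbF/=.
      by case: (i == j); case: (i == k); case: (j == k).
    apply: etrans (prob_iterated6 ZU (e := fun z => (z.1 != z.2.1) &&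
      (det (z.1, z.2.2.2.1) (z.2.1, z.2.2.2.2.1) (z.2.2.1, z.2.2.2.2.2) == 0)) u _) _.
      apply: measurable_and.
        by apply: measurable_neg; apply: measurable_fun_eqr; mproj.
      by apply: measurable_fun_eqr => //; apply: measurable_det; mproj.
    apply: I01_eq0 => x1 _; apply: I01_eq0 => x2 _; apply: I01_eq0 => x3 _.
    apply: I01_eq0 => y1 _; apply: I01_eq0 => y2 _.
    (* The height above [x3] of the line through the first two points. *)
    apply: (@I01_point _ (y1 + (x3 - x1) * (y2 - y1) / (x2 - x1))) => y3 _ /= y3P.
    have [//|x12] := eqVneq x1 x2.
    rewrite /= (_ : det _ _ _ == 0 = false)//; apply/negbTE; apply: contra y3P.
    rewrite /det/= => /eqP D; apply/eqP.
    apply: (@mulfI _ (x2 - x1)); first by rewrite subr_eq0 eq_sym.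
    transitivity ((x2 - x1) * y1 + (x3 - x1) * (y2 - y1)); first by lra.
    by field; rewrite subr_eq0 eq_sym.
  - by move=> w /= /negP; rewrite /b negb_imply negbK.
have coords : {ae P, forall w, forall kk : K * K, (kk.1 != kk.2) ==>
    (Z kk.1 w != Z kk.2 w)}.
  apply: filter_forall => -[k1 k2]/=.
  case: (boolP (k1 != k2)) => [k12|_]; last exact: nearW.
  by have := coord _ _ k12.
have detss : {ae P, forall w, forall t : 'I_n * 'I_n * 'I_n,
    uniq [:: t.1.1; t.1.2; t.2] ==> ((Z (t.1.1, false) w != Z (t.1.2, false) w) ==>
       (det (point Z t.1.1 w) (point Z t.1.2 w) (point Z t.2 w) != 0))}.
  apply: filter_forall => -[[i j] k].
  case: (boolP (uniq _)) => [u|_]; last exact: nearW.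
  by have := dets _ _ _ u.
apply: filterS2 coords detss => w C D; split; last split.
- by move=> i j ij; have := C ((i, false), (j, false)); rewrite /= xpair_eqE/= andbT ij.
- by move=> i j ij; have := C ((i, true), (j, true)); rewrite /= xpair_eqE/= andbT ij.
- move=> i j k u; have := D (i, j, k); rewrite u/= => /implyP; apply.
  have := C ((i, false), (j, false)); rewrite /= xpair_eqE/= andbT.
  by move: u; rewrite /= inE negb_or => /andP[/andP[-> _] _].
Qed.

End generic.

(** * Expected numbers of crossings *)

Lemma sum_uniq4 n : (\sum_(i < n) \sum_(j < n) \sum_(k < n) \sum_(l < n)
  uniq [:: i; j; k; l] = n ^_ 4)%N.
Proof.
have sum_notin (s : seq 'I_n) : uniq s -> (\sum_(i < n) (i \notin s) = n - size s)%N.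
  move=> us; have := cardC (mem s); rewrite card_ord (card_uniqP us) => nE.
  rewrite -big_mkcond/= sum1_card.
  have <- : #|[predC mem s]| = (n - size s)%N by rewrite -[X in (X - _)%N]nE addKn.
  by apply: eq_card => x; rewrite !inE.
have step (s : seq 'I_n) :
    (\sum_(i < n) uniq (rcons s i) = uniq s * (n - size s))%N.
  transitivity (\sum_(i < n) (uniq s * (i \notin s)))%N.
    by apply: eq_bigr => i _; rewrite rcons_uniq andbC mulnb.
  rewrite -big_distrr/=; case: (boolP (uniq s)) => us; last by rewrite !mul0n.
  by rewrite sum_notin.
transitivity (\sum_(i < n) \sum_(j < n) \sum_(k < n) (uniq [:: i; j; k] * (n - 3)))%N.
  apply: eq_bigr => i _; apply: eq_bigr => j _; apply: eq_bigr => k _.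
  exact: (step [:: i; j; k]).
transitivity (\sum_(i < n) \sum_(j < n) (uniq [:: i; j] * (n - 2) * (n - 3)))%N.
  apply: eq_bigr => i _; apply: eq_bigr => j _; rewrite -big_distrl/=.
  by congr muln; exact: (step [:: i; j]).
transitivity (\sum_(i < n) ((n - 1) * (n - 2) * (n - 3)))%N.
  apply: eq_bigr => i _; rewrite -!big_distrl/=.
  by do 2! congr muln; rewrite (step [:: i]) mul1n.
rewrite sum_nat_const card_ord.
by rewrite !ffactnSr ffactn0 mul1n subn0 !mulnA.
Qed.

Section expectations.
Context d (T : measurableType d) (R : realType) (P : probability T R) (n : nat).
Local Notation RR := (measurableTypeR R).
Local Notation event4 := (plane R -> plane R -> plane R -> plane R -> bool).
Local Notation K := ('I_n * bool)%type.

Definition Enat (f : T -> nat) : \bar R := (\int[P]_w ((f w)%:R)%:E)%E.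

Definition mnat (f : T -> nat) := measurable_fun setT (fun w => (f w)%:R : R).

Lemma mnatD f g : mnat f -> mnat g -> mnat (fun w => f w + g w)%N.
Proof.
move=> mf mg; rewrite /mnat; under eq_fun do rewrite natrD.
exact: measurable_funD.
Qed.

Lemma mnat_sum (I : finType) (f : I -> T -> nat) : (forall i, mnat (f i)) ->
  mnat (fun w => \sum_i f i w)%N.
Proof.
move=> mf; rewrite /mnat; under eq_fun do rewrite natr_sum.
exact: measurable_sum.
Qed.

Lemma mnat_bool (b : T -> bool) : measurable_fun setT b -> mnat (fun w => b w : nat).
Proof.
move=> mb; rewrite /mnat.
have -> : (fun w => (b w)%:R) = \1_[set w | b w] :> (T -> R).
  by apply/funext => w; rewrite indicE; congr (_%:R);
    congr nat_of_bool; apply/idP/idP; rewrite inE.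
exact: measurable_indic (measurable_pred mb).
Qed.

Lemma EnatD f g : mnat f -> mnat g ->
  Enat (fun w => f w + g w)%N = (Enat f + Enat g)%E.
Proof.
move=> mf mg; rewrite /Enat -ge0_integralD//.
- by apply: eq_integral => w _; rewrite natrD EFinD.
- by apply: measurableT_comp => //; exact: mf.
- by apply: measurableT_comp => //; exact: mg.
Qed.

Lemma Enat_sum (I : finType) (f : I -> T -> nat) : (forall i, mnat (f i)) ->
  Enat (fun w => \sum_i f i w)%N = (\sum_i Enat (f i))%E.
Proof.
move=> mf; rewrite /Enat -ge0_integral_sum//.
- by apply: eq_integral => w _; rewrite natr_sum sumEFin.
- by move=> i; apply: measurableT_comp => //; exact: mf.
Qed.

Lemma Enat_bool (b : T -> bool) : measurable_fun setT b ->
  Enat (fun w => b w : nat) = P [set w | b w].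
Proof.
move=> mb; rewrite /Enat -[X in P X]setIT -integral_indic//; last exact: measurable_pred.
by apply: eq_integral => w _; rewrite indicE; congr (_%:R%:E); congr nat_of_bool;
  apply/idP/idP; rewrite inE.
Qed.

Lemma Enat_ae f g : {ae P, forall w, f w = g w} -> Enat f = Enat g.
Proof.
move=> fg; apply: ge0_ae_eq_integral_nonmeasurable => //.
by apply: filterS fg => w ->.
Qed.

Definition sum4 (F : 'I_n -> 'I_n -> 'I_n -> 'I_n -> nat) : nat :=
  (\sum_i \sum_j \sum_k \sum_l F i j k l)%N.

Lemma sum4D F G :
  (sum4 (fun i j k l => F i j k l + G i j k l) = sum4 F + sum4 G)%N.
Proof.
rewrite /sum4 -big_split; apply: eq_bigr => i _; rewrite -big_split.
apply: eq_bigr => j _; rewrite -big_split; apply: eq_bigr => k _.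
by rewrite -big_split.
Qed.

Lemma eq_sum4 F G : (forall i j k l, F i j k l = G i j k l) -> sum4 F = sum4 G.
Proof.
by move=> FG; apply: eq_bigr => i _; apply: eq_bigr => j _; apply: eq_bigr => k _;
  apply: eq_bigr => l _.
Qed.

(** Like [sum4_1423], it passes from quadruples listed edge by edge to quadruples listed from left
    to right. *)
Lemma sum4_1324 F : sum4 (fun i j k l => F i k j l) = sum4 F.
Proof. by apply: eq_bigr => i _; rewrite exchange_big. Qed.

Lemma sum4_1423 F : sum4 (fun i j k l => F i k l j) = sum4 F.
Proof.
apply: eq_bigr => i _; rewrite exchange_big; apply: eq_bigr => k _.
by rewrite exchange_big.
Qed.

Lemma mnat_sum4 (f : 'I_n -> 'I_n -> 'I_n -> 'I_n -> T -> nat) :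
  (forall i j k l, mnat (f i j k l)) ->
  mnat (fun w => sum4 (fun i j k l => f i j k l w)).
Proof. by move=> mf; do 4! apply: mnat_sum => ?. Qed.

Lemma Enat_sum4 (f : 'I_n -> 'I_n -> 'I_n -> 'I_n -> T -> nat) (v : R) :
  (forall i j k l, mnat (f i j k l)) ->
  (forall i j k l, uniq [:: i; j; k; l] -> Enat (f i j k l) = v%:E) ->
  (forall i j k l w, ~~ uniq [:: i; j; k; l] -> f i j k l w = 0%N) ->
  Enat (fun w => sum4 (fun i j k l => f i j k l w)) = (v * (n ^_ 4)%:R)%:E.
Proof.
move=> mf fv f0.
have E i j k l : Enat (f i j k l) = (v * (uniq [:: i; j; k; l])%:R)%:E.
  case: (boolP (uniq _)) => u; first by rewrite fv// mulr1.
  rewrite mulr0 /Enat (eq_integral (cst 0%E)) ?integral0// => w _.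
  by rewrite f0.
rewrite Enat_sum; last by move=> i; do 3! apply: mnat_sum => ?.
rewrite -sum_uniq4 natr_sum mulr_sumr -sumEFin; apply: eq_bigr => i _.
rewrite Enat_sum; last by move=> j; do 2! apply: mnat_sum => ?.
rewrite natr_sum mulr_sumr -sumEFin; apply: eq_bigr => j _.
rewrite Enat_sum; last by move=> k; apply: mnat_sum => ?.
rewrite natr_sum mulr_sumr -sumEFin; apply: eq_bigr => k _.
rewrite Enat_sum//.
by rewrite natr_sum mulr_sumr -sumEFin; apply: eq_bigr => l _; exact: E.
Qed.

End expectations.

Section counting_expectations.
Context d (T : measurableType d) (R : realType) (P : probability T R) (n : nat).
Local Notation RR := (measurableTypeR R).
Local Notation event4 := (plane R -> plane R -> plane R -> plane R -> bool).
Local Notation K := ('I_n * bool)%type.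

Definition measurable4 (e : event4) :=
  forall d' (S : measurableType d') (a b c f : S -> plane R),
    measurable_fun setT a -> measurable_fun setT b -> measurable_fun setT c ->
    measurable_fun setT f ->
  measurable_fun setT (fun s => e (a s) (b s) (c s) (f s)).

Lemma sorted4_uniq (p : 'I_n -> plane R) i j k l :
  sorted4 (p i) (p j) (p k) (p l) -> uniq [:: i; j; k; l].
Proof.
have neq x y : (p x).1 < (p y).1 -> x != y by apply: contraTneq => ->; rewrite ltxx.
move=> /and3P[ij jk kl]; have ik := lt_trans ij jk; have jl := lt_trans jk kl.
have il := lt_trans ij jl.
by rewrite /= !inE !negb_or !neq.
Qed.

Variable Z : K -> T -> RR.
Hypothesis ZU : indep_uniform P Z.

Definition count4 (s t : bool) (e : event4) (w : T) : nat :=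
  sum4 (fun i j k l => reflected s t e (point Z i w) (point Z j w) (point Z k w) (point Z l w)).

Let measurable_reflected (e : event4) s t i j k l : measurable4 e ->
  mnat R (fun w => reflected s t e (point Z i w) (point Z j w) (point Z k w) (point Z l w) : nat).
Proof.
move=> me; apply: mnat_bool; have ZU' := indep_uniform_reflect s t ZU.
have mp x : measurable_fun setT (fun w => reflect2 s t (point Z x w)).
  exact: (measurable_point x ZU').
by rewrite /reflected; case: s {ZU'} mp => mp; apply: me.
Qed.

Lemma mnat_count4 s t e : measurable4 e -> mnat R (count4 s t e).
Proof. by move=> me; apply: mnat_sum4 => i j k l; exact: measurable_reflected. Qed.

(** Since [e] implies [sorted4], quadruples with a repeated index contribute 0, and each of the
    [n ^_ 4] others contributes [v]. A reflection in x reverses the quadruple, which stays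
    duplicate-free. *)
Lemma Enat_count4 s t e v : measurable4 e -> has_prob4 P n e v ->
  (forall a b c f, e a b c f -> sorted4 a b c f) ->
  Enat P (count4 s t e) = (v * (n ^_ 4)%:R)%:E.
Proof.
move=> me ev es; have ZU' := indep_uniform_reflect s t ZU.
apply: Enat_sum4 => [i j k l|i j k l u|i j k l w u].
- exact: measurable_reflected.
- rewrite Enat_bool; last first.
    have mp x : measurable_fun setT (fun w => reflect2 s t (point Z x w)).
      exact: (measurable_point x ZU').
    by rewrite /reflected; case: s {ZU'} mp => mp; apply: me.
  rewrite /reflected; case: s ZU' => ZU'; last exact: (ev _ ZU').
  by apply: (ev _ ZU'); rewrite -rev_uniq.
- apply/eqP; rewrite eqb0; apply: contra u; rewrite /reflected.
  case: s {ZU'} => /es; last exact: (sorted4_uniq (p := fun i => reflect2 false t (point Z i w))).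
  move/(sorted4_uniq (p := fun i => reflect2 true t (point Z i w))).
  by rewrite -rev_uniq.
Qed.

End counting_expectations.

(** * Numbers of crossings as sums over quadruples *)

Section crossing_counts.
Context (R : realType) (n : nat) (p : 'I_n -> plane R).
Hypothesis gen : generic p.

Lemma generic_det i j k l : sorted4 (p i) (p j) (p k) (p l) ->
  [/\ det (p i) (p j) (p k) != 0, det (p i) (p j) (p l) != 0,
      det (p i) (p k) (p l) != 0 & det (p j) (p k) (p l) != 0].
Proof.
case: gen => _ [_ g3] /sorted4_uniq/=; rewrite !inE !negb_or.
case/and4P=> /and3P[ij ik il] /andP[jk jl] kl _.
by split; apply: g3; rewrite /= !inE negb_or ?ij ?ik ?il ?jk ?jl ?kl.
Qed.

Lemma generic_snd i j k l : sorted4 (p i) (p j) (p k) (p l) ->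
  [/\ (p i).2 != (p j).2, (p i).2 != (p k).2, (p i).2 != (p l).2 &
     [/\ (p j).2 != (p k).2, (p j).2 != (p l).2 & (p k).2 != (p l).2]].
Proof.
case: gen => _ [g2 _] /sorted4_uniq/=; rewrite !inE !negb_or.
by case/and4P=> /and3P[ij ik il] /andP[jk jl] kl _; split; [..|split]; apply: g2.
Qed.

Lemma crE : cr p (complete_edges 'I_n) =
  sum4 (fun i j k l => cross1324 (p i) (p j) (p k) (p l) + cross1423 (p i) (p j) (p k) (p l))%N.
Proof.
have -> : cr p (complete_edges 'I_n) =
    sum4 (crossing4 p (fun _ _ : {set 'I_n} => True)).
  rewrite /sum4 -card_crossing//; apply: eq_card => c; rewrite !inE.
  apply/asboolP/asboolP => -[e [f [-> eE fE ef h]]]; exists e, f; split => //.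
  by case: h.
rewrite [RHS]sum4D -[X in _ = (X + _)%N]sum4_1324 -[X in _ = (_ + X)%N]sum4_1423 -sum4D.
apply: eq_sum4 => i j k l; rewrite /crossing4.
have -> : `[< True >] by exact/asboolP.
rewrite andbT; case: (boolP (cross1324 _ _ _ _)) => [h|_ //].
move: h => /andP[/and3P[_ _ jl] _].
rewrite (_ : cross1423 _ _ _ _ = false) ?orbF ?addn0//.
apply/negbTE; apply/negP => /andP[/and3P[_ _ lj] _].
by have := lt_trans jl lj; rewrite ltxx.
Qed.

Lemma cr_monoE : cr_mono p (complete_edges 'I_n) (chi_slope p) =
  sum4 (fun i j k l =>
   ((cross1324 (p i) (p j) (p k) (p l) && (((p i).2 < (p k).2) == ((p j).2 < (p l).2)))%R
   + (cross1423 (p i) (p j) (p k) (p l) && (((p i).2 < (p l).2) == ((p j).2 < (p k).2)))%R)%N).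
Proof.
have -> : cr_mono p (complete_edges 'I_n) (chi_slope p) =
    sum4 (crossing4 p (fun e f => chi_slope p e = chi_slope p f)).
  rewrite /sum4 -card_crossing//.
rewrite [RHS]sum4D -[X in _ = (X + _)%N]sum4_1324 -[X in _ = (_ + X)%N]sum4_1423 -sum4D.
apply: eq_sum4 => i j k l; rewrite /crossing4.
case: (boolP (cross1324 _ _ _ _)) => [/andP[/and3P[ik kj jl] _]|_] /=.
  rewrite (_ : cross1423 _ _ _ _ = false)/=; last first.
    apply/negbTE; apply/negP => /andP[/and3P[_ _ lj] _].
    by have := lt_trans jl lj; rewrite ltxx.
  rewrite addn0; congr nat_of_bool; rewrite (chi_slopeE (lt_trans ik kj)).
  rewrite (chi_slopeE (lt_trans kj jl)).
  by apply/asboolP/eqP.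
case: (boolP (cross1423 _ _ _ _)) => //= /andP[/and3P[ik kl lj] _].
congr nat_of_bool; rewrite (chi_slopeE kl) (chi_slopeE (lt_trans ik (lt_trans kl lj))).
by apply/asboolP/eqP.
Qed.

End crossing_counts.

Section expected_counts.
Context d (T : measurableType d) (R : realType) (P : probability T R) (n : nat).
Local Notation RR := (measurableTypeR R).
Local Notation K := ('I_n * bool)%type.
Variable Z : K -> T -> RR.
Hypothesis ZU : indep_uniform P Z.

Let pos w := fun i : 'I_n => point Z i w.
Let count := count4 Z.

Let mc s t e : measurable4 e -> mnat R (count s t e).
Proof. exact: (mnat_count4 ZU). Qed.

Let mE := @Enat_count4 d T R P n Z ZU.

Lemma Enat_cr : Enat P (fun w => cr (pos w) (complete_edges 'I_n)) =
  (25 / 864 * (n ^_ 4)%:R)%:E.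
Proof.
pose C w := sum4 (fun i j k l => cross1324 (point Z i w) (point Z j w) (point Z k w) (point Z l w)
   + cross1423 (point Z i w) (point Z j w) (point Z k w) (point Z l w))%N.
pose L w := (count false false (@inner_second R) w + count false true (@inner_second R) w
  + (count true true (@inner_second R) w + count true false (@inner_second R) w))%N.
have mev : measurable4 (@inner_second R) by move=> *; exact: measurable_inner_second.
have msort : measurable4 (@sorted4 R) by move=> *; exact: measurable_sorted4.
have mC : mnat R C.
  by apply: mnat_sum4 => i j k l; apply: mnatD; apply: mnat_bool;
    [apply: measurable_cross1324|apply: measurable_cross1423]; exact: (measurable_point _ ZU).
have mL : mnat R L by do ?apply: mnatD; exact: mc.
have evLs a b c f : @inner_second R a b c f -> sorted4 a b c f by case/and4P.
have EL : Enat P L = (11 / 864 * (n ^_ 4)%:R)%:E.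
  have E s t : Enat P (count s t (@inner_second R)) = (11 / 3456 * (n ^_ 4)%:R)%:E.
    by apply: mE => //; exact: prob_inner_second.
  do 3! (rewrite EnatD; [|by do ?apply: mnatD; exact: mc|by do ?apply: mnatD; exact: mc]).
  by rewrite !E -!EFinD; congr (_%:E); field.
have ES : Enat P (count false false (@sorted4 R)) = (1 / 24 * (n ^_ 4)%:R)%:E.
  by apply: mE => //; exact: prob_sorted4.
have CL : (Enat P C + Enat P L)%E = Enat P (count false false (@sorted4 R)).
  rewrite -EnatD//; apply: Enat_ae.
  apply: filterS (ae_generic ZU) => w gen.
  rewrite /C /L /count /count4 -!sum4D; apply: eq_sum4 => i j k l.
  by rewrite !addnA; apply: conv_partition => /(generic_det gen).
have -> : Enat P (fun w => cr (pos w) (complete_edges 'I_n)) = Enat P C.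
  by apply: Enat_ae; apply: filterS (ae_generic ZU) => w gen; exact: crE.
(* Subtracting in the extended reals requires [Enat P C] to be finite, which the finite total
   forces. *)
move: CL; rewrite EL ES; case: (Enat P C) => // r [E].
by congr (_%:E); move: E; rewrite (_ : 25 / 864 = 1 / 24 - 11 / 864 :> R); [lra|field].
Qed.

Lemma Enat_cr_mono :
  Enat P (fun w => cr_mono (pos w) (complete_edges 'I_n) (chi_slope (pos w))) =
  (1 / 96 * (n ^_ 4)%:R)%:E.
Proof.
pose A4 e w := (count false false e w + count false true e w
  + (count true true e w + count true false e w))%N.
pose A2 e w := (count false false e w + count false true e w)%N.
pose M w := (A4 (@inc1324_cup R) w + A4 (@inc1324_dip R) w
  + (A2 (@inc1423_above R) w + A2 (@inc1423_below R) w))%N.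
have m3 : measurable4 (@inc1324_cup R) by move=> *; exact: measurable_inc1324_cup.
have m4 : measurable4 (@inc1324_dip R) by move=> *; exact: measurable_inc1324_dip.
have m2a : measurable4 (@inc1423_above R) by move=> *; exact: measurable_inc1423_above.
have m2b : measurable4 (@inc1423_below R) by move=> *; exact: measurable_inc1423_below.
have mA4 e : measurable4 e -> mnat R (A4 e) by move=> me; do ?apply: mnatD; exact: mc.
have mA2 e : measurable4 e -> mnat R (A2 e) by move=> me; do ?apply: mnatD; exact: mc.
have EA2 e v : measurable4 e -> has_prob4 P n e v ->
    (forall a b c f, e a b c f -> sorted4 a b c f) ->
    Enat P (A2 e) = (2 * v * (n ^_ 4)%:R)%:E.
  move=> me ev es; rewrite /A2 EnatD; [|exact: mc..].
  by rewrite !(mE _ _ me ev es) -EFinD; congr (_%:E); ring.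
have EA4 e v : measurable4 e -> has_prob4 P n e v ->
    (forall a b c f, e a b c f -> sorted4 a b c f) ->
    Enat P (A4 e) = (4 * v * (n ^_ 4)%:R)%:E.
  move=> me ev es; rewrite /A4.
  do 3! (rewrite EnatD; [|by do ?apply: mnatD; exact: mc|by do ?apply: mnatD; exact: mc]).
  by rewrite !(mE _ _ me ev es) -!EFinD; congr (_%:E); ring.
have -> : Enat P (fun w => cr_mono (pos w) (complete_edges 'I_n) (chi_slope (pos w))) =
    Enat P M.
  apply: Enat_ae; apply: filterS (ae_generic ZU) => w gen; rewrite (cr_monoE gen).
  rewrite /M /A4 /A2 /count /count4 -!sum4D; apply: eq_sum4 => i j k l.
  congr addn.
    apply: mono1324_partition; first by case/(generic_det gen).
    by case/(generic_snd gen) => ? ? _ [].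
  apply: mono1423_partition; first by case/(generic_det gen).
  by case/(generic_snd gen) => _ _ ? [].
rewrite EnatD; [|by apply: mnatD; exact: mA4|by apply: mnatD; exact: mA2].
rewrite EnatD; [|exact: mA4..].
rewrite EnatD; [|exact: mA2..].
rewrite (EA4 _ (1 / 3456))//; [|exact: prob_inc1324_cup|by move=> ? ? ? ? /andP[]].
rewrite (EA4 _ (1 / 1728))//; [|exact: prob_inc1324_dip|by move=> ? ? ? ? /andP[]].
rewrite (EA2 _ (1 / 3456))//; [|exact: prob_inc1423_above|by move=> ? ? ? ? /andP[]].
rewrite (EA2 _ (11 / 3456))//; [|exact: prob_inc1423_below|by move=> ? ? ? ? /andP[]].
by rewrite -!EFinD; congr (_%:E); field.
Qed.

End expected_counts.

(** * From random points to independent coordinates *)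

Section coordinates.
Context d (T : measurableType d) (R : realType) (P : probability T R) (n : nat).
Local Notation RR := (measurableTypeR R).

Definition coordinate (X : 'I_n -> T -> plane R) (k : 'I_n * bool) (w : T) : RR :=
  if k.2 then (X k.1 w).2 else (X k.1 w).1.

Lemma point_coordinate X i w : point (coordinate X) i w = X i w.
Proof. by rewrite /point /coordinate/= -surjective_pairing. Qed.

(** Independence between points is the hypothesis for the full index set; independence of the two
    coordinates of one point comes from evaluating the product Lebesgue measure on a rectangle. *)
Lemma indep_uniform_coordinate (X : 'I_n -> {RV P >-> plane R}) :
    mutually_independent X -> (forall i, uniform_on_unit_square (X i)) ->
  indep_uniform P (coordinate (fun i => X i)).
Proof.
move=> Xi Xu; split=> [[i b]|A mA].
  have mX : measurable_fun setT (X i) by exact: measurable_funPT.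
  rewrite /coordinate/=; case: b.
    exact: (measurableT_comp measurable_snd mX).
  exact: (measurableT_comp measurable_fst mX).
pose B i : set (plane R) := A (i, false) `*` A (i, true).
have mB i : measurable (B i) by exact: measurableX.
transitivity (P (\bigcap_(i in [set` [set: 'I_n]%SET]) (X i @^-1` B i))).
  congr (P _); apply/seteqP; split=> [w Aw i _|w Bw [i b] _].
    by split; [exact: (Aw (i, false) I)|exact: (Aw (i, true) I)].
  have [|Bf Bt] := Bw i; first by rewrite /= finset.in_setT.
  by case: b.
rewrite (Xi _ B mB) big_mkcond/=.
transitivity (\prod_(i : 'I_n) \prod_(b : bool) lambda01 R (A (i, b)))%E; last first.
  rewrite pair_big; apply: eq_bigr => -[i b] _ //.
apply: eq_bigr => i _; rewrite finset.in_setT big_bool/= [RHS]muleC.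
have -> : P (X i @^-1` B i) = distribution P (X i) (B i) by [].
rewrite (Xu i _ (mB i)) /B -setXI.
have m01 : measurable (`[0, 1] : set RR) by exact: measurable_itv.
rewrite product_measure1E; [|exact: measurableI..].
by rewrite !lambda01E.
Qed.

End coordinates.

Theorem mainTheorem2 (R : realType) (d : measure_display)
    (T : measurableType d) (P : probability T R) (n : nat)
    (X : 'I_n -> {RV P >-> plane R})
    (X_indep : mutually_independent X)
    (X_unif : forall i : 'I_n, uniform_on_unit_square (X i)) :
  let pos (w : T) := fun i : 'I_n => X i w in
  let E := complete_edges 'I_n in
  let E_cr := ('E_P[fun w => (cr (pos w) E)%:R])%E in
  let E_cr_slope :=
    ('E_P[fun w => (cr_mono (pos w) E (chi_slope (pos w)))%:R])%E in
  [/\ E_cr_slope = ((1 / 4) * ('C(n, 4))%:R)%:E,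
      ((1 / 4) * ('C(n, 4))%:R)%:E = ((18 / 50)%:E * E_cr)%E &
      ((18 / 50)%:E * E_cr = (1 / 2 - 7 / 50)%:E * E_cr)%E].
Proof.
move=> pos E E_cr E_cr_slope.
have ZU := indep_uniform_coordinate X_indep X_unif.
have posE w : pos w = fun i => point (coordinate (fun i => X i)) i w.
  by apply/funext => i; rewrite point_coordinate.
(* Each 4-element set has 24 orderings: 24 * 25/864 = 25/36 and 24 * 1/96 = 1/4, with ratio 9/25 =
   18/50. *)
have ffact4 : (n ^_ 4)%:R = 24 * ('C(n, 4))%:R :> R.
  by rewrite -bin_ffact natrM mulrC.
have crE : E_cr = ((25 / 36) * ('C(n, 4))%:R)%:E.
  rewrite /E_cr unlock; under eq_fun do rewrite posE.
  by apply: etrans (Enat_cr ZU) _; rewrite ffact4; congr (_%:E); field.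
split.
- rewrite /E_cr_slope unlock; under eq_fun do rewrite posE.
  by apply: etrans (Enat_cr_mono ZU) _; rewrite ffact4; congr (_%:E); field.
- by rewrite [X in (_ * X)%E]crE -!EFinM; congr (_%:E); field.
- by congr (_%:E * _)%E; field.
Qed.
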